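(* Let $I=[0,1]$, $d\in(0,d^* )$, with $d^*$ and $\mathcal{C}(d)\in(0,1)$ as in the context. Let $(\rho_0,J_0)\in L^\infty(I)$ with $\int_I\rho_0\,dx=0$, and let $(\rho,J)$ be the weak solution of $$\partial_t\rho+\partial_xJ=0,\qquad \partial_tJ+\partial_x\rho=-2d\,\alpha(t)J,\qquad x\in I,\ t\ge0,$$ $$(\rho,J)(\cdot,0)=(\rho_0,J_0),\qquad J(0,t)=J(1,t)=0 .$$ (a) If $\alpha(t)\equiv1$, there exist constants $C_1,C_2,C_3>0$, depending only on the equation and on the initial data, such that for all $t\ge 0$ $$\|J(\cdot,t)\|_{L^\infty}\le C_1e^{-C_3t},\qquad \|\rho(\cdot,t)\|_{L^\infty}\le C_2e^{-C_3t},$$ with $C_3=|\ln(\mathcal{C}(d))|$. (b) If $\alpha$ is of ''on-off'' type, i.e. for some $0<T_1<T_2$ one has $\alpha(t)=1$ for $t\in[0,T_1)$, $\alpha(t)=0$ for $t\in[T_1,T_2)$, and $\alpha(t+T_2)=\alpha(t)$ for all $t>0$, and if $T_1\ge1$, then there exist constants $C_1,C_2>0$, depending only on the equation and on the initial data, such that the same two estimates hold with $$C_3=\frac{[T_1]}{T_2}\,|\ln(\mathcal{C}(d))|,$$ where $[T_1]\ge1$ denotes the integer part of $T_1$.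
   Context: The constants: for $d\ge 0$, $$\mathcal{C}(d)=e^{-d}\left(1+(1+d)^2\left(e^{d}-d-1\right)\right),$$ and $d^*>0$ is the number such that $\mathcal{C}(d^* )=1$ and $0<\mathcal{C}(d)<1$ for all $0<d<d^*$ (it exists since $\mathcal{C}(0)=1$, $\mathcal{C}'(0)=-1$ and $\mathcal{C}(d)\to+\infty$ as $d\to+\infty$). Weak solution of the problem: a function $(\rho,J):I\times[0,+\infty)\to\mathbb{R}^2$ such that (a) $t\mapsto(\rho,J)(\cdot,t)\in L^\infty(I)\subset L^1(I)$ is continuous on $[0,\infty)$ with respect to the $L^1(I)$ norm and equals $(\rho_0,J_0)$ at $t=0$; (b) $\int_0^\infty\int_0^1\{\rho\,\partial_t\phi+J\,\partial_x\phi\}\,dx\,dt=0$ for all $\phi\in C^1([0,1]\times(0,\infty))$ with compact support in $[0,1]\times(0,\infty)$ (this encodes the boundary condition), and $\int_0^\infty\int_0^1\{J\,\partial_t\phi+\rho\,\partial_x\phi-2d\,\alpha(t)J\phi\}\,dx\,dt=0$ for all $\phi\in C^1$ with compact support in $(0,1)\times(0,\infty)$. For $(\rho_0,J_0)\in L^\infty(I)$ with $\int_I\rho_0=0$ such a weak solution exists and is unique. *)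

(* Defs.v *)
From mathcomp Require Import all_boot all_order all_algebra.
From mathcomp Require Import all_classical all_reals all_analysis.

Set Implicit Arguments.
Unset Strict Implicit.
Unset Printing Implicit Defensive.

Import Order.TTheory GRing.Theory Num.Theory.
Import numFieldNormedType.Exports.

Local Open Scope classical_set_scope.
Local Open Scope ring_scope.

Definition calC {R : realType} (d : R) : R :=
  expR (- d) * (1 + (1 + d) ^+ 2 * (expR d - d - 1)).

(* At most one number satisfies this: a larger one would force
   [calC dstar < 1]. *)
Definition is_dstar {R : realType} (dstar : R) : Prop :=
  [/\ 0 < dstar, calC dstar = 1 &
      forall d : R, 0 < d < dstar -> 0 < calC d < 1].

(* The spaces L^p(I), I = [0, 1]: functions are total on R, and their values
   outside I are discarded by extending them by zero from I. *)
Definition normI {R : realType} (p : \bar R) (f : R -> R) : \bar R :=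
  'N[@lebesgue_measure R]_p[EFin \o (f \_ `[0, 1])].

Definition LinftyI {R : realType} (f : R -> R) : Prop :=
  (f \_ `[0, 1]) \in Lfun (@lebesgue_measure R) +oo%E.

Definition continuous_L1 {R : realType} (u : R -> R -> R) : Prop :=
  forall t0 : R, 0 <= t0 ->
    normI 1%E (fun x => u x t - u x t0)
      @[t --> within `[0, +oo[%classic (nbhs t0)] --> 0%E.

(* [phi] is C^1 with compact support in X x (0, +oo), where X is [0, 1] or
   ]0, 1[, and [phit], [phix] are its partial derivatives.  At x = 0 and x = 1
   being C^1 means that the derivatives taken in the interior extend
   continuously up to the boundary; the ambient derivatives of [phi] there
   would depend on its irrelevant values outside [0, 1]. *)
Definition test_function {R : realType} (X : set R)
    (phi phit phix : R -> R -> R) : Prop :=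
  let Q : set (R * R) := X `*` `]0, +oo[ in
  [/\ {within Q, continuous (fun p : R * R => phi p.1 p.2)},
      {within Q, continuous (fun p : R * R => phit p.1 p.2)},
      {within Q, continuous (fun p : R * R => phix p.1 p.2)},
      (forall x t : R, 0 < x < 1 -> 0 < t ->
         is_derive t 1 (fun s : R => phi x s) (phit x t) /\
         is_derive x 1 (fun y : R => phi y t) (phix x t)) &
      exists K : set (R * R),
        [/\ compact K, K `<=` Q &
            forall x t : R, Q (x, t) -> ~ K (x, t) -> phi x t = 0]].

(* The integrals over space-time are iterated ones, as
   [t |-> (rho, J)(., t)] is only required to be a continuous curve in L^1(I). *)
Definition weak_solution {R : realType} (d : R) (alpha rho0 J0 : R -> R)
    (rho J : R -> R -> R) : Prop :=
  let mu := @lebesgue_measure R in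
  [/\ (forall t : R, 0 <= t -> LinftyI (rho^~ t) /\ LinftyI (J^~ t)),
      continuous_L1 rho /\ continuous_L1 J,
      {ae mu, forall x, `[0, 1]%classic x -> rho x 0 = rho0 x /\ J x 0 = J0 x},
      (forall phi phit phix : R -> R -> R,
         test_function `[0, 1]%classic phi phit phix ->
         (\int[mu]_(t in `]0%R, +oo[) \int[mu]_(x in `[0%R, 1%R])
            (rho x t * phit x t + J x t * phix x t)%:E = 0)%E) &
      (forall phi phit phix : R -> R -> R,
         test_function `]0, 1[%classic phi phit phix ->
         (\int[mu]_(t in `]0%R, +oo[) \int[mu]_(x in `[0%R, 1%R])
            (J x t * phit x t + rho x t * phix x t
             - 2 * d * alpha t * J x t * phi x t)%:E = 0)%E)].

Definition on_off {R : realType} (alpha : R -> R) (T1 T2 : R) : Prop :=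
  [/\ 0 < T1 < T2,
      (forall t : R, 0 <= t < T1 -> alpha t = 1),
      (forall t : R, T1 <= t < T2 -> alpha t = 0) &
      (forall t : R, 0 < t -> alpha (t + T2) = alpha t)].

(* Main.v *)
(** Write [f = (rho + J) / 2] and [g = (rho - J) / 2].  Since [J] vanishes at
    the end points, [f] on [[0, 1]] and the mirror image of [g] on [[-1, 0]]
    fit together to one function [G] on the circle [R / 2 Z], and the system
    becomes [G_t + G_x = - d alpha (G (x) - G (- x))]: mass travels at speed
    one and is reflected, [x |-> - x], at rate [d alpha].  Expand the solution
    after one unit of time with [alpha = 1] by the number of reflections.  No
    reflection contributes [e^-d] times a translate of [G]; exactly one
    reflection contributes the mean of [G] over the whole circle, which is
    zero; two or more have total weight [e^-d (e^d - 1 - d)].  Hence the sup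
    norm shrinks by [e^-d (e^d - d) <= calC d] per unit of time, and it never
    grows.  To work with continuous functions, [G] is convolved with even
    periodic kernels, which commute with translations and the reflection; the
    weak formulation, tested with these kernels transported along the
    characteristics, yields a differential equation in time.  Kernels
    approximating indicators of intervals and Lebesgue differentiation give
    back the bound on [rho] and [J]. *)

Require Import Defs.
From mathcomp Require Import all_boot all_order all_algebra.
From mathcomp Require Import all_classical all_reals all_analysis.
From mathcomp Require Import ess_sup_inf measurable_realfun ring lra.

Set Implicit Arguments.
Unset Strict Implicit.
Unset Printing Implicit Defensive.

Import Order.TTheory GRing.Theory Num.Theory.
Import numFieldNormedType.Exports.

Local Open Scope classical_set_scope.
Local Open Scope ring_scope.

(** Three obstacles shape the proof. The second equation may be tested only away from the ends of
    [I], so the odd part of the kernel has to be cut off there. The slope [1 / e] of the cutoff does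
    no harm: an odd [2]-periodic function vanishes at [0] and at [1], hence is [O(e)] where the
    cutoff varies.

    Along one characteristic the equation is driven by values at mirrored points, which lie on other
    characteristics, so Gronwall's lemma on a single one does not close. A Picard iteration from any
    crude bound, uniform in the centre [z] of the kernel, leaves an error [(d t)^n / n!] that
    disappears.

    Unit time steps come from the geometry: a path reflected once at time [s] starts from a point
    that depends on [s] with speed two, so one unit of time sweeps the circle of length two exactly
    once. That is why single reflections yield a full mean.

    All bounds are carried as [M * (2 * h)], proportional to the mass of the kernel and free of its
    steepness, which permits the final passage to indicators and then to points. *)

Section derivation_rules.
Context {R : realType}.
Implicit Types (f g : R -> R) (x a b k : R).

Lemma is_derive1D f g x a b : is_derive x 1 f a -> is_derive x 1 g b ->
  is_derive x 1 (fun y => f y + g y) (a + b).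
Proof. exact: is_deriveD. Qed.

Lemma is_derive1B f g x a b : is_derive x 1 f a -> is_derive x 1 g b ->
  is_derive x 1 (fun y => f y - g y) (a - b).
Proof. exact: is_deriveB. Qed.

Lemma is_derive1M f g x a b : is_derive x 1 f a -> is_derive x 1 g b ->
  is_derive x 1 (fun y => f y * g y) (a * g x + f x * b).
Proof.
move=> df dg; apply: (is_derive_eq (is_deriveM df dg)).
by rewrite /GRing.scale/= addrC mulrC.
Qed.

Lemma is_derive1Z f x a k : is_derive x 1 f a ->
  is_derive x 1 (fun y => k * f y) (k * a).
Proof.
move=> df; apply: (is_derive_eq (is_derive1M (is_derive_cst k x 1) df)).
by rewrite mul0r add0r.
Qed.

Lemma is_derive1_affine f x a k c : is_derive (k * x + c) 1 f a ->
  is_derive x 1 (fun y => f (k * y + c)) (k * a).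
Proof.
move=> df; rewrite mulrC.
have dk : is_derive x 1 (fun y => k * y + c) k.
  apply: (is_derive_eq (is_derive1D (is_derive1Z k (is_derive_id x 1))
    (is_derive_cst c x 1))).
  by rewrite mulr1 addr0.
exact: (@is_derive1_comp _ f (fun y => k * y + c)).
Qed.

Lemma is_derive1_derivable f x a : is_derive x 1 f a -> derivable f x 1.
Proof. by case. Qed.

Lemma is_derive1_derive1 f x a : is_derive x 1 f a -> f^`()%classic x = a.
Proof. by rewrite derive1E => -[]. Qed.

Lemma is_derive1_continuous f x a : is_derive x 1 f a -> {for x, continuous f}.
Proof.
by move=> /is_derive1_derivable ?; exact/differentiable_continuous/derivable1_diffP.
Qed.

End derivation_rules.

(** * Smooth cutoffs *)

Section smoothstep.
Context {R : realType}.
Implicit Types (x s : R).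

Definition pospart x : R := Num.max x 0.

Lemma pospart_ge0E x : 0 <= x -> pospart x = x.
Proof. by move=> x0; rewrite /pospart; apply/max_idPl. Qed.

Lemma pospart_le0E x : x <= 0 -> pospart x = 0.
Proof. by move=> x0; rewrite /pospart; apply/max_idPr. Qed.

Lemma continuous_pospart : continuous pospart.
Proof. by move=> x; apply: continuous_max; [exact: cvg_id|exact: cvg_cst]. Qed.

Lemma is_derive_pospart_sqr x :
  is_derive x 1 (fun y => pospart y ^+ 2) (2 * pospart x).
Proof.
have [x0|x0|->] := ltgtP x 0.
- apply: (@near_eq_is_derive _ _ _ (cst 0)).
    near=> y; rewrite pospart_le0E ?expr0n//.
    by apply/ltW; near: y; exact: lt_nbhsl.
  by apply: is_derive_eq; rewrite pospart_le0E ?mulr0// ltW.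
- apply: (@near_eq_is_derive _ _ _ (fun y : R => y ^+ 2)).
    near=> y; rewrite pospart_ge0E//.
    by apply/ltW; near: y; exact: lt_nbhsr.
  by apply: is_derive_eq; rewrite pospart_ge0E ?(ltW x0)//= /GRing.scale /=; ring.
- apply/is_derive1_caratheodory; exists pospart; split.
  + move=> z; rewrite (@pospart_le0E 0)// expr0n/= !subr0.
    by have [z0|z0] := leP z 0; [rewrite pospart_le0E//|rewrite pospart_ge0E ?ltW//]; ring.
  + exact: continuous_pospart.
  + by rewrite pospart_le0E ?mulr0.
Unshelve. all: by end_near. Qed.

(** The tent on [[0, 2]] with peak value [1]. Its primitive [smoothstep] rises from [0] to [1] and
    is C^1, the regularity asked of test functions. *)
Definition hat s : R := pospart s - 2 * pospart (s - 1) + pospart (s - 2).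

Definition smoothstep s : R :=
  (pospart s ^+ 2 - 2 * pospart (s - 1) ^+ 2 + pospart (s - 2) ^+ 2) / 2.

Lemma smoothstep_le0 s : s <= 0 -> smoothstep s = 0.
Proof. by move=> s0; rewrite /smoothstep !pospart_le0E; lra. Qed.

Lemma smoothstep_ge2 s : 2 <= s -> smoothstep s = 1.
Proof. by move=> s0; rewrite /smoothstep !pospart_ge0E; lra. Qed.

Lemma hat_out s : s <= 0 \/ 2 <= s -> hat s = 0.
Proof.
by move=> [s0|s0]; rewrite /hat; [rewrite !pospart_le0E|rewrite !pospart_ge0E]; lra.
Qed.

Lemma hat_itv s : 0 <= hat s <= 1.
Proof.
rewrite /hat.
have [s0|s0] := lerP s 0; first by rewrite !pospart_le0E; lra.
have [s1|s1] := lerP s 1.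
  by rewrite pospart_ge0E ?(@pospart_le0E (s - 1)) ?(@pospart_le0E (s - 2)); lra.
have [s2|s2] := lerP s 2.
  by rewrite pospart_ge0E ?(@pospart_ge0E (s - 1)) ?(@pospart_le0E (s - 2)); lra.
by rewrite !pospart_ge0E; lra.
Qed.

Lemma smoothstep_itv s : 0 <= smoothstep s <= 1.
Proof.
rewrite /smoothstep.
have [s0|s0] := lerP s 0; first by rewrite !pospart_le0E; lra.
have [s1|s1] := lerP s 1.
  by rewrite pospart_ge0E ?(@pospart_le0E (s - 1)) ?(@pospart_le0E (s - 2)); nra.
have [s2|s2] := lerP s 2.
  by rewrite pospart_ge0E ?(@pospart_ge0E (s - 1)) ?(@pospart_le0E (s - 2)); nra.
by rewrite !pospart_ge0E; lra.
Qed.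

Lemma continuous_hat : continuous hat.
Proof.
move=> s; apply: cvgD; first apply: cvgB.
- exact: continuous_pospart.
- apply: cvgM; first exact: cvg_cst.
  apply: (@continuous_comp _ _ _ (fun s => s - 1) pospart); last exact: continuous_pospart.
  by apply: cvgB; [exact: cvg_id|exact: cvg_cst].
- apply: (@continuous_comp _ _ _ (fun s => s - 2) pospart); last exact: continuous_pospart.
  by apply: cvgB; [exact: cvg_id|exact: cvg_cst].
Qed.

Lemma is_derive_smoothstep s : is_derive s 1 smoothstep (hat s).
Proof.
have h a : is_derive s 1 (fun y => pospart (y - a) ^+ 2) (2 * pospart (s - a)).
  have := @is_derive1_affine _ (fun y => pospart y ^+ 2) s (2 * pospart (s - a)) 1 (- a).
  rewrite !mul1r => /(_ (is_derive_pospart_sqr (s - a))).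
  by under eq_fun do rewrite mul1r.
have := h 0; rewrite subr0 => h0.
have -> : smoothstep = fun s => 2^-1 * (pospart (s - 0) ^+ 2 -
    2 * pospart (s - 1) ^+ 2 + pospart (s - 2) ^+ 2).
  by apply/funext => y; rewrite /smoothstep subr0; field.
apply: (is_derive_eq (is_derive1Z 2^-1
  (is_derive1D (is_derive1B h0 (is_derive1Z 2 (h 1))) (h 2)))).
by rewrite /hat; field.
Qed.

End smoothstep.

(** * Integrals of continuous functions and the du Bois-Reymond lemma *)

Section interval_integrals.
Context {R : realType}.
Notation mu := (@lebesgue_measure R).
Implicit Types (a b t : R) (f g F A B : R -> R).

Lemma within_itv_integrable a b f : {within `[a, b], continuous f} ->
  mu.-integrable `[a, b] (EFin \o f).
Proof. by move=> cf; apply: continuous_compact_integrable => //; exact: segment_compact. Qed.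

Lemma Rintegral_FTC2 f F a b : a <= b ->
  {within `[a, b], continuous f} -> {within `[a, b], continuous F} ->
  (forall x, x \in `]a, b[%R -> is_derive x 1 F (f x)) ->
  \int[mu]_(x in `[a, b]) f x = F b - F a.
Proof.
rewrite le_eqVlt => /predU1P[->|ab] cf cF dF.
  by rewrite set_itv1 Rintegral_set1 subrr.
rewrite /Rintegral (@continuous_FTC2 _ f F)//.
- have [? ? ?] := (continuous_within_itvP F ab).1 cF.
  by split => // x xab; exact: is_derive1_derivable (dF x xab).
- by move=> x xab; exact: is_derive1_derive1 (dF x xab).
Qed.

Lemma itv_lebesgueE a b : a <= b -> fine (mu `[a, b]) = b - a.
Proof.
move=> ab; rewrite lebesgue_measure_itv/= lte_fin.
by case: ltgtP ab => // ->; rewrite subrr.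
Qed.

Lemma normr_Rintegral_le f g a b :
  {within `[a, b], continuous f} -> {within `[a, b], continuous g} ->
  (forall x, x \in `[a, b] -> `|f x| <= g x) ->
  `|\int[mu]_(x in `[a, b]) f x| <= \int[mu]_(x in `[a, b]) g x.
Proof.
move=> cf cg fg; apply: le_trans; first apply: le_normr_Rintegral => //.
  exact: within_itv_integrable.
apply: le_Rintegral => //.
- by apply: within_itv_integrable => x; apply: cvg_norm; exact: cf.
- exact: within_itv_integrable.
Qed.

(** A rise from [0] to [1] over [[t1, t1 + 2 e]], whose derivative [dramp] is an approximate Dirac
    mass at [t1]. The argument is written in the affine form of [is_derive1_affine]. *)
Definition ramp t1 e t := smoothstep (e^-1 * t + - (e^-1 * t1)).
Definition dramp t1 e t := e^-1 * hat (e^-1 * t + - (e^-1 * t1)).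

Lemma is_derive_ramp t1 e t : is_derive t 1 (ramp t1 e) (dramp t1 e t).
Proof. exact/is_derive1_affine/is_derive_smoothstep. Qed.

Lemma continuous_dramp t1 e : continuous (dramp t1 e).
Proof.
move=> t; apply: cvgM; first exact: cvg_cst.
apply: (@continuous_comp _ _ _ (fun t => e^-1 * t + _) hat); last exact: continuous_hat.
by apply: cvgD; [apply: cvgM; [exact: cvg_cst|exact: cvg_id]|exact: cvg_cst].
Qed.

Lemma continuous_ramp t1 e : continuous (ramp t1 e).
Proof.
by move=> t; exact: is_derive1_continuous (is_derive_ramp t1 e t).
Qed.

Lemma ramp_le t1 e t : 0 < e -> t <= t1 -> ramp t1 e t = 0.
Proof.
by move=> e0 tt1; apply: smoothstep_le0; rewrite subr_le0 ler_pM2l// invr_gt0.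
Qed.

Lemma ramp_ge t1 e t : 0 < e -> t1 + 2 * e <= t -> ramp t1 e t = 1.
Proof.
move=> e0 tt1; apply: smoothstep_ge2.
by rewrite -mulrBr mulrC ler_pdivlMr//; lra.
Qed.

Lemma dramp_ge0 t1 e t : 0 < e -> 0 <= dramp t1 e t.
Proof.
by move=> e0; rewrite mulr_ge0 ?invr_ge0 ?(ltW e0)//; case/andP: (hat_itv (e^-1 * t + - (e^-1 * t1))).
Qed.

Lemma dramp_out t1 e t : 0 < e -> t <= t1 \/ t1 + 2 * e <= t -> dramp t1 e t = 0.
Proof.
move=> e0 h; rewrite /dramp hat_out ?mulr0//; case: h => h; [left|right].
  by rewrite subr_le0 ler_pM2l// invr_gt0.
by rewrite -mulrBr mulrC ler_pdivlMr//; lra.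
Qed.

Lemma Rintegral_dramp a b t1 e : 0 < e -> a <= t1 -> t1 + 2 * e <= b ->
  \int[mu]_(t in `[a, b]) dramp t1 e t = 1.
Proof.
move=> e0 at1 t1b; transitivity (ramp t1 e b - ramp t1 e a); last first.
  by rewrite (ramp_ge (t := b))// ramp_le// subr0.
apply: Rintegral_FTC2.
- lra.
- exact/continuous_subspaceT/continuous_dramp.
- exact/continuous_subspaceT/continuous_ramp.
- by move=> x _; exact: is_derive_ramp.
Qed.

Lemma dramp_approx a b t1 e f eta : 0 < e -> a <= t1 -> t1 + 2 * e <= b ->
  {within `[a, b], continuous f} ->
  (forall t, t1 <= t <= t1 + 2 * e -> `|f t - f t1| <= eta) ->
  `|\int[mu]_(t in `[a, b]) (dramp t1 e t * f t) - f t1| <= eta.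
Proof.
move=> e0 at1 t1b cf fe.
have cd : {within `[a, b], continuous (dramp t1 e)}.
  exact/continuous_subspaceT/continuous_dramp.
have cc (k : R) : {within `[a, b], continuous (fun=> k)}.
  by apply: continuous_subspaceT => x; exact: cvg_cst.
have -> : f t1 = \int[mu]_(t in `[a, b]) (dramp t1 e t * f t1).
  by rewrite RintegralZr ?Rintegral_dramp ?mul1r//; exact: within_itv_integrable.
have cM (g h : R -> R) : {within `[a, b], continuous g} ->
    {within `[a, b], continuous h} -> {within `[a, b], continuous (fun t => g t * h t)}.
  by move=> cg ch x; apply: cvgM; [exact: cg|exact: ch].
rewrite -RintegralB//; [|exact/within_itv_integrable/cM..].
have -> : eta = \int[mu]_(t in `[a, b]) (dramp t1 e t * eta).
  by rewrite RintegralZr ?Rintegral_dramp ?mul1r//; exact: within_itv_integrable.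
apply: normr_Rintegral_le.
- by move=> x; apply: cvgB; apply: cM.
- exact: cM.
- move=> t _; rewrite -mulrBr normrM ger0_norm ?dramp_ge0//.
  have [tt1|tt1] := leP t t1; first by rewrite dramp_out ?mul0r//; left.
  have [tt2|tt2] := leP (t1 + 2 * e) t; first by rewrite dramp_out ?mul0r//; right.
  by rewrite ler_wpM2l ?dramp_ge0// fe// (ltW tt1) (ltW tt2).
Qed.

Lemma within_itvM a b f g : {within `[a, b], continuous f} ->
  {within `[a, b], continuous g} -> {within `[a, b], continuous (fun t => f t * g t)}.
Proof. by move=> cf cg x; apply: cvgM; [exact: cf|exact: cg]. Qed.

Lemma within_itvD a b f g : {within `[a, b], continuous f} ->
  {within `[a, b], continuous g} -> {within `[a, b], continuous (fun t => f t + g t)}.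
Proof. by move=> cf cg x; apply: cvgD; [exact: cf|exact: cg]. Qed.

Lemma within_itvB a b f g : {within `[a, b], continuous f} ->
  {within `[a, b], continuous g} -> {within `[a, b], continuous (fun t => f t - g t)}.
Proof. by move=> cf cg x; apply: cvgB; [exact: cf|exact: cg]. Qed.

Lemma is_derive_primitive a b f x : {in `]a, b[%R, continuous f} ->
  forall c, a < c -> c < x -> x < b ->
  is_derive x 1 (fun t => \int[mu]_(s in `[c, t]) f s) (f x).
Proof.
move=> cf c ac cx xb; pose u := (x + b) / 2.
have xu : x < u by rewrite /u; lra.
have ub : u < b by rewrite /u; lra.
have iu : mu.-integrable `[c, u] (EFin \o f).
  apply: within_itv_integrable; apply: continuous_in_subspaceT => t /[!inE]/=.
  by rewrite in_itv/= => /andP[? ?]; apply: cf; rewrite in_itv/=; lra.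
have [|//|dG G'] := @continuous_FTC1_closed _ f c x u xu iu.
  by [].
  by apply: cf; rewrite in_itv/=; lra.
by split => //; rewrite -derive1E.
Qed.

(** The hypothesis is [A' = B] in the sense of distributions, tested only with differences of two
    ramps. Subtracting a primitive [G] of [B] leaves [C = A - G] with zero weak derivative, and
    shrinking the ramps compares [C] at [t1] with [C] at [t2]. *)
Lemma du_bois_reymond a b A B :
  {in `]a, b[%R, continuous A} -> {in `]a, b[%R, continuous B} ->
  (forall t1 t2 e, a < t1 -> t1 < t2 -> 0 < e -> t2 + 2 * e < b ->
    \int[mu]_(t in `[t1, t2 + 2 * e])
       ((dramp t1 e t - dramp t2 e t) * A t + (ramp t1 e t - ramp t2 e t) * B t) = 0) ->
  forall t1 t2, a < t1 -> t1 <= t2 -> t2 < b ->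
    A t2 - A t1 = \int[mu]_(t in `[t1, t2]) B t.
Proof.
move=> cA cB AB t1 t2 at1; rewrite le_eqVlt => /predU1P[<- _|t12 t2b].
  by rewrite set_itv1 Rintegral_set1 subrr.
(* The primitive starts strictly before [t1], so that it is differentiable at [t1] as well. *)
pose a1 := (a + t1) / 2; pose b1 := (t2 + b) / 2.
pose G t := \int[mu]_(s in `[a1, t]) B s.
have aa1 : a < a1 by rewrite /a1; lra.
have a1t1 : a1 < t1 by rewrite /a1; lra.
have dG t : a1 < t -> t < b -> is_derive t 1 G (B t).
  by move=> a1t tb; apply: is_derive_primitive cB _ _ _ _.
have cG t : a1 < t -> t < b -> {for t, continuous G}.
  by move=> ? ?; apply: is_derive1_continuous (dG t _ _).
pose C t := A t - G t.
have cC t : a1 < t -> t < b -> {for t, continuous C}.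
  move=> a1t tb; apply: cvgB; last exact: cG.
  by apply: cA; rewrite in_itv/=; lra.
have cw (f : R -> R) u v : (forall t, u <= t <= v -> {for t, continuous f}) ->
    {within `[u, v], continuous f}.
  move=> h; apply: continuous_in_subspaceT => t /[!inE]/=.
  by rewrite in_itv/= => /h.
have -> : \int[mu]_(t in `[t1, t2]) B t = G t2 - G t1.
  apply: Rintegral_FTC2.
  - exact: ltW.
  - apply: cw => t /andP[? ?]; apply: cB; rewrite in_itv/=; lra.
  - by apply: cw => t /andP[? ?]; apply: cG; lra.
  - by move=> t; rewrite in_itv/= => /andP[? ?]; apply: dG; lra.
suff : C t1 = C t2 by rewrite /C; lra.
apply/eqP; rewrite -subr_eq0 -normr_le0; apply/ler_addgt0Pl => eta eta0.
rewrite addr0.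
have e20 : 0 < eta / 2 by rewrite divr_gt0.
have /cvgrPdist_le/(_ _ e20)/nbhs_ballP[d1 /= d10 hd1] := cC t1 a1t1 (lt_trans t12 t2b).
have /cvgrPdist_le/(_ _ e20)/nbhs_ballP[d2 /= d20 hd2] := cC t2 (lt_trans a1t1 t12) t2b.
(* The ramps, of width [2 e], must end before [b] and stay where [C] is within [eta / 2] of its
   values at [t1] and [t2]. *)
pose e := Num.min (b - t2) (Num.min d1 d2) / 4.
have e0 : 0 < e by rewrite divr_gt0// !lt_min subr_gt0 t2b d10 d20.
have [eb [ed1 ed2]] : e <= (b - t2) / 4 /\ (e <= d1 / 4 /\ e <= d2 / 4).
  by rewrite /e; split; [|split]; rewrite ler_pM2r// !ge_min lexx ?orbT.
have Tb : t2 + 2 * e < b by lra.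
set T := t2 + 2 * e in Tb.
pose th t := ramp t1 e t - ramp t2 e t; pose dth t := dramp t1 e t - dramp t2 e t.
have dthE t : is_derive t 1 th (dth t).
  by apply: is_derive1B; exact: is_derive_ramp.
have cth t : {for t, continuous th} by exact: is_derive1_continuous (dthE t).
have cdth t : {for t, continuous dth} by apply: cvgB; exact: continuous_dramp.
have AB0 := AB _ _ _ at1 t12 e0 Tb.
have cGT : {within `[t1, T], continuous G} by apply: cw => t /andP[? ?]; apply: cG; lra.
have cCT : {within `[t1, T], continuous C} by apply: cw => t /andP[? ?]; apply: cC; lra.
have cBT : {within `[t1, T], continuous B}.
  by apply: cw => t /andP[? ?]; apply: cB; rewrite in_itv/=; lra.
have cAT : {within `[t1, T], continuous A}.
  by apply: cw => t /andP[? ?]; apply: cA; rewrite in_itv/=; lra.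
have cthT : {within `[t1, T], continuous th} by apply: cw => t _; exact: cth.
have cdthT : {within `[t1, T], continuous dth} by apply: cw => t _; exact: cdth.
(* The integrand is the derivative of [th * G], and [th] vanishes at both ends. *)
have GB0 : \int[mu]_(t in `[t1, T]) (dth t * G t + th t * B t) = 0.
  transitivity (th T * G T - th t1 * G t1).
    apply: (@Rintegral_FTC2 _ (fun t => th t * G t)).
    - by rewrite /T; lra.
    - by apply: within_itvD; exact: within_itvM.
    - exact: within_itvM.
    - move=> t; rewrite in_itv/= => /andP[? ?].
      have dGt : is_derive t 1 G (B t) by apply: dG; lra.
      exact: (is_derive1M (dthE t) dGt).
  have -> : th t1 = 0 by rewrite /th !ramp_le ?subrr// ltW.
  have -> : th T = 0 by rewrite /th !ramp_ge ?subrr// /T; lra.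
  by rewrite !mul0r subrr.
have C0 : \int[mu]_(t in `[t1, T]) (dramp t1 e t * C t) =
          \int[mu]_(t in `[t1, T]) (dramp t2 e t * C t).
  have cd t0 : mu.-integrable `[t1, T] (EFin \o (fun t => dramp t0 e t * C t)).
    apply: within_itv_integrable; apply: within_itvM => //.
    exact/continuous_subspaceT/continuous_dramp.
  apply/eqP; rewrite -subr_eq0 -RintegralB//; [|exact: cd..].
  have /eqP := AB0; rewrite -[X in _ == X]GB0 -subr_eq0 -RintegralB//; last first.
    by apply: within_itv_integrable; apply: within_itvD; exact: within_itvM.
    by apply: within_itv_integrable; apply: within_itvD; exact: within_itvM.
  by apply: etrans; congr (_ == _); apply: eq_Rintegral => t _; rewrite /dth /th /C; ring.
have h1 : `|\int[mu]_(t in `[t1, T]) (dramp t1 e t * C t) - C t1| <= eta / 2.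
  apply: dramp_approx => //; first by rewrite /T; lra.
  move=> t /andP[? ?]; rewrite distrC; apply: hd1; rewrite /ball/= ltr_norml; lra.
have h2 : `|\int[mu]_(t in `[t1, T]) (dramp t2 e t * C t) - C t2| <= eta / 2.
  apply: dramp_approx => //; first exact: ltW.
  move=> t /andP[? ?]; rewrite distrC; apply: hd2; rewrite /ball/= ltr_norml; lra.
rewrite -C0 in h2; move: h1 h2; rewrite !ler_norml => /andP[? ?] /andP[? ?].
by apply/andP; split; lra.
Qed.

End interval_integrals.

(** * Pairing bounded functions with continuous ones *)

Section bounded_on_I.
Context {R : realType}.
Notation mu := (@lebesgue_measure R).
Notation I01 := (`[0%R, 1%R]%classic : set R).
Implicit Types (f g c : R -> R) (M C : R).

Definition ae_bounded M f :=
  measurable_fun I01 f /\ {ae mu, forall x, I01 x -> `|f x| <= M}.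

Lemma mI01 : measurable I01. Proof. exact: measurable_itv. Qed.
Hint Resolve mI01 : core.

Lemma muI01 : mu I01 = 1%E.
Proof. by rewrite lebesgue_measure_itv/= lte01 sube0. Qed.

Lemma muT_gt0 : (0 < mu setT)%E.
Proof.
apply: (@lt_le_trans _ _ (mu I01)); first by rewrite muI01.
by apply: le_measure => //; rewrite inE.
Qed.

Lemma LinftyI_ae_bounded f : LinftyI f -> exists2 M, 0 <= M & ae_bounded M f.
Proof.
rewrite /LinftyI inE => /andP[]; rewrite !inE/= /finite_norm => mf.
rewrite unlock /Lnorm muT_gt0 => fin.
have {}mf : measurable_fun I01 f by apply/(measurable_restrictT f mI01).
have [M hM] := @ess_supr_bounded _ _ _ mu (fun x => `|(f \_ I01) x|) fin.
exists `|M| => //; split => //; apply: filterS hM => x /= + Dx.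
by rewrite patchE mem_set// => /le_trans; apply; exact: ler_norm.
Qed.

Lemma normIy_le M f : 0 <= M -> {ae mu, forall x, I01 x -> `|f x| <= M} ->
  (normI +oo f <= M%:E)%E.
Proof.
move=> M0 fM; rewrite /normI unlock /Lnorm muT_gt0; apply/ess_supP.
apply: filterS fM; first exact: (ae_filter_ringOfSetsType mu).
move=> x /= fxM; change (`|(f \_ I01) x|%:E <= M%:E)%E; rewrite lee_fin patchE.
by case: ifPn => [/set_mem/fxM//|_]; rewrite normr0.
Qed.

Lemma normI1E f : normI 1 f = (\int[mu]_(x in I01) `|f x|%:E)%E.
Proof.
rewrite /normI Lnorm1 [RHS]integral_mkcond; apply: eq_integral => x _.
by rewrite /= !patchE; case: ifPn => //; rewrite normr0.
Qed.

Lemma ae_bounded_integrableM M f C c : ae_bounded M f -> measurable_fun I01 c ->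
  (forall x, I01 x -> `|c x| <= C) -> mu.-integrable I01 (EFin \o (fun x => f x * c x)).
Proof.
move=> [mf fM] mc cC; apply/integrableP; split.
  exact/measurable_EFinP/measurable_funM.
apply: (@le_lt_trans _ _ (\int[mu]_(x in I01) (`|M| * `|C|)%:E)%E); last first.
  by rewrite integral_cst//= lebesgue_measure_itv/= lte01 sube0 mule1 ltry.
apply: ae_ge0_le_integral => //.
- exact/measurableT_comp/measurable_EFinP/measurable_funM.
- apply: filterS fM; first exact: (ae_filter_ringOfSetsType mu).
  move=> x fM Ix; rewrite /= lee_fin normrM.
  by apply: ler_pM => //; [apply: le_trans (fM Ix) _|apply: le_trans (cC _ Ix) _]; exact: ler_norm.
Qed.

Lemma ae_bounded_integrable M f : ae_bounded M f -> mu.-integrable I01 (EFin \o f).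
Proof.
move=> fM; have := @ae_bounded_integrableM M f 1 (cst 1) fM (measurable_cst _).
have -> : (fun x => f x * cst 1 x) = f by apply/funext => x; rewrite mulr1.
by apply => x _; rewrite normr1.
Qed.

Lemma Rintegral_norm_integrable f : mu.-integrable I01 (EFin \o f) ->
  mu.-integrable I01 (EFin \o (fun x => `|f x|)).
Proof. by move=> /integrable_norm; apply. Qed.

Lemma ae_bounded_pairing_le M f c : 0 <= M -> ae_bounded M f ->
  mu.-integrable I01 (EFin \o c) ->
  mu.-integrable I01 (EFin \o (fun x => f x * c x)) ->
  `|\int[mu]_(x in I01) (f x * c x)| <= M * \int[mu]_(x in I01) `|c x|.
Proof.
move=> M0 [mf fM] ic ifc.
apply: le_trans; first exact: le_normr_Rintegral.
have inc := Rintegral_norm_integrable ic.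
have infc := Rintegral_norm_integrable ifc.
rewrite -RintegralZl//.
have iM : mu.-integrable I01 (EFin \o (fun x => M * `|c x|)).
  rewrite (_ : _ \o _ = fun x => (M%:E * (`|c x|)%:E)%E); last exact/funext.
  exact: integrableZl.
rewrite -lee_fin /Rintegral !fineK; [|exact: integrable_fin_num..].
apply: ae_ge0_le_integral => //.
- exact: measurable_int infc.
- by move=> x _; rewrite lee_fin mulr_ge0.
- exact: measurable_int iM.
- apply: filterS fM; first exact: (ae_filter_ringOfSetsType mu).
  by move=> x fM Ix; rewrite lee_fin normrM ler_wpM2r ?fM.
Qed.

(** The Hölder bound with the roles exchanged: [f] enters through its L^1 norm, the norm in which
    the solution is continuous in time. *)
Lemma pairing_le_L1 f c C :
  mu.-integrable I01 (EFin \o f) ->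
  mu.-integrable I01 (EFin \o (fun x => f x * c x)) ->
  (forall x, I01 x -> `|c x| <= C) ->
  `|\int[mu]_(x in I01) (f x * c x)| <= (\int[mu]_(x in I01) `|f x|) * C.
Proof.
move=> i_f ifc cC.
apply: le_trans; first exact: le_normr_Rintegral.
have inf := Rintegral_norm_integrable i_f.
rewrite -RintegralZr//; apply: le_Rintegral => //.
- exact: Rintegral_norm_integrable.
- rewrite (_ : _ \o _ = fun x => ((`|f x|)%:E * C%:E)%E); last exact/funext.
  exact: integrableZr.
- by move=> x Ix; rewrite normrM ler_wpM2l ?cC.
Qed.

End bounded_on_I.
#[global] Hint Resolve mI01 : core.

(** * Continuity in time of integrals against continuous functions *)

Section time_continuity.
Context {R : realType}.
Notation mu := (@lebesgue_measure R).
Notation I01 := (`[0%R, 1%R]%classic : set R).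
Implicit Types (u c : R -> R -> R) (t : R).

(** A tube argument: compactness of [I] makes joint continuity at the points [(x, t0)] uniform in
    [x]. *)
Lemma near_uniform_I c t0 e : continuous (fun p : R * R => c p.1 p.2) -> 0 < e ->
  \forall t \near t0, forall x, I01 x -> `|c x t - c x t0| <= e.
Proof.
move=> cc e0.
have e20 : 0 < e / 2 by rewrite divr_gt0.
have /compact_near_coveringP : compact I01 by exact: segment_compact.
move=> /(_ R (nbhs t0) (fun t x => `|c x t - c x t0| <= e) _); apply.
move=> x _.
have /cvgrPdist_le/(_ _ e20) h := cc (x, t0).
have [[U V] /= [Ux Vt] UV] := h.
exists (U, V) => //= -[y t] /= [Uy Vt'].
have := UV (y, t) (conj Uy Vt').
have := UV (y, t0) (conj Uy (nbhs_singleton Vt)).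
rewrite /= !ler_norml => /andP[? ?] /andP[? ?]; lra.
Qed.

Lemma continuous_sectionx c t : continuous (fun p : R * R => c p.1 p.2) ->
  continuous (fun x => c x t).
Proof.
move=> cc x; apply: (@continuous_comp _ _ _ (fun x => (x, t)) (fun p : R * R => c p.1 p.2)).
  by apply: (@cvg_pair _ _ _ _ (nbhs x) (nbhs t)); [exact: cvg_id|exact: cvg_cst].
exact: cc.
Qed.

Lemma continuous_I_bounded (f : R -> R) : continuous f ->
  exists2 C, 0 < C & forall x, I01 x -> `|f x| <= C.
Proof.
move=> cf; have := @continuous_compact _ _ f I01.
move=> /(_ (continuous_subspaceT cf) (@segment_compact _ _ _))/compact_bounded[M [_ hM]].
exists (`|M| + 1) => [|x Ix]; first by rewrite ltr_wpDl.
by apply: hM; [rewrite (le_lt_trans (ler_norm _))// ltrDl|exists x].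
Qed.

Lemma continuous_measurable_I (f : R -> R) : continuous f -> measurable_fun I01 f.
Proof. by move=> cf; apply: measurable_funTS; exact: continuous_measurable_fun. Qed.

Lemma Linfty_pairing_integrable f (c : R -> R) : LinftyI f -> continuous c ->
  mu.-integrable I01 (EFin \o (fun x => f x * c x)).
Proof.
move=> /LinftyI_ae_bounded[M _ fM] cc.
have [C _ hC] := continuous_I_bounded cc.
exact: ae_bounded_integrableM fM (continuous_measurable_I cc) hC.
Qed.

Lemma Linfty_integrable (f : R -> R) : LinftyI f -> mu.-integrable I01 (EFin \o f).
Proof. by move=> /LinftyI_ae_bounded[M _ fM]; exact: ae_bounded_integrable fM. Qed.

Lemma within_half_line (f : R -> R) (a b : R) : 0 <= a ->
  (forall t, 0 <= t -> f s @[s --> within `[0, +oo[%classic (nbhs t)] --> f t) ->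
  {within `[a, b], continuous f}.
Proof.
move=> a0 cf; apply/subspace_continuousP => t /=; rewrite in_itv/= => /andP[at_ _].
apply: cvg_trans (cf t (le_trans a0 at_)); apply: cvg_app; apply: within_subset.
by move=> s /=; rewrite !in_itv/= andbT => /andP[/(le_trans a0)].
Qed.

Lemma L1_dist_near u t0 e : (forall t, 0 <= t -> LinftyI (u^~ t)) ->
  continuous_L1 u -> 0 <= t0 -> 0 < e ->
  \forall t \near within `[0, +oo[%classic (nbhs t0),
    \int[mu]_(x in I01) `|u x t - u x t0| <= e.
Proof.
move=> uL uC t00 e0; have := uC _ t00.
move/fine_cvgP => [_ /cvgrPdist_le/(_ _ e0)]; apply: filterS => t /=.
rewrite sub0r normrN normI1E -/(Rintegral _ _ _); apply: le_trans.
exact: ler_norm.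
Qed.

Lemma pairing_cvg u c t0 : (forall t, 0 <= t -> LinftyI (u^~ t)) ->
  continuous_L1 u -> continuous (fun p : R * R => c p.1 p.2) -> 0 <= t0 ->
  \int[mu]_(x in I01) (u x t * c x t) @[t --> within `[0, +oo[%classic (nbhs t0)]
  --> \int[mu]_(x in I01) (u x t0 * c x t0).
Proof.
move=> uL uC cc t00; apply/cvgrPdist_le => e e0.
have [C C0 hC] := continuous_I_bounded (@continuous_sectionx c t0 cc).
pose N := \int[mu]_(x in I01) `|u x t0|.
have N0 : 0 <= N by apply: Rintegral_ge0.
have h1 : 0 < e / (2 * (C + 1)) by rewrite divr_gt0// mulr_gt0//; lra.
(* The minimum with [1] bounds [c] by [C + 1] on [I] at times near [t0]. *)
have h2 : 0 < Num.min 1 (e / (2 * (N + 1))).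
  by rewrite lt_min ltr01 divr_gt0// mulr_gt0//; lra.
have H1 := L1_dist_near uL uC t00 h1.
have H2 : \forall t \near within `[0, +oo[%classic (nbhs t0),
    forall x, I01 x -> `|c x t - c x t0| <= Num.min 1 (e / (2 * (N + 1))).
  by apply: cvg_within; exact: near_uniform_I.
have H3 : \forall t \near within `[0, +oo[%classic (nbhs t0), 0 <= t.
  by apply: filterS (withinT _ _) => t /=; rewrite in_itv/= andbT.
near=> t.
have t0' : 0 <= t by near: t.
have d1 : \int[mu]_(x in I01) `|u x t - u x t0| <= e / (2 * (C + 1)) by near: t.
have d2 : forall x, I01 x -> `|c x t - c x t0| <= Num.min 1 (e / (2 * (N + 1))) by near: t.
have ct s := @continuous_sectionx c s cc.
have i1 s r : 0 <= s -> mu.-integrable I01 (EFin \o (fun x => u x s * c x r)).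
  by move=> s0; apply: (@Linfty_pairing_integrable (u^~ s) (c^~ r)) => //; exact: uL.
have i2 s : 0 <= s -> mu.-integrable I01 (EFin \o u^~ s).
  by move=> s0; apply: Linfty_integrable; exact: uL.
have iB (f g : R -> R) : mu.-integrable I01 (EFin \o f) -> mu.-integrable I01 (EFin \o g) ->
    mu.-integrable I01 (EFin \o (fun x => f x - g x)).
  by move=> fi gi; rewrite (_ : _ \o _ = (EFin \o f) \- (EFin \o g))%E; [exact: integrableB|exact/funext].
have -> : \int[mu]_(x in I01) (u x t0 * c x t0) - \int[mu]_(x in I01) (u x t * c x t) =
   - (\int[mu]_(x in I01) ((u x t - u x t0) * c x t) + \int[mu]_(x in I01) (u x t0 * (c x t - c x t0))).
  under [X in _ = - (X + _)]eq_Rintegral do rewrite mulrBl.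
  under [X in _ = - (_ + X)]eq_Rintegral do rewrite mulrBr.
  rewrite RintegralB//; [|exact: i1..].
  rewrite RintegralB//; [|exact: i1..].
  ring.
rewrite normrN (le_trans (ler_normD _ _))//.
have b1 : `|\int[mu]_(x in I01) ((u x t - u x t0) * c x t)| <= e / (2 * (C + 1)) * (C + 1).
  apply: (le_trans (pairing_le_L1 (C := C + 1) _ _ _)).
  - by apply: iB; apply: i2.
  - rewrite (_ : (fun x => _) = fun x => u x t * c x t - u x t0 * c x t); last first.
      by apply/funext => x; rewrite mulrBl.
    by apply: iB; apply: i1.
  - move=> x Ix; have := d2 _ Ix; rewrite le_min => /andP[+ _]; have := hC _ Ix.
    by rewrite !ler_norml => /andP[? ?] /andP[? ?]; lra.
  - by rewrite ler_wpM2r//; lra.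
have b2 : `|\int[mu]_(x in I01) (u x t0 * (c x t - c x t0))| <= N * (e / (2 * (N + 1))).
  apply: (le_trans (pairing_le_L1 (C := e / (2 * (N + 1))) _ _ _)) => //.
  - exact: i2.
  - rewrite (_ : (fun x => _) = fun x => u x t0 * c x t - u x t0 * c x t0); last first.
      by apply/funext => x; rewrite mulrBr.
    by apply: iB; apply: i1.
  - by move=> x Ix; have := d2 _ Ix; rewrite le_min => /andP[].
apply: (le_trans (lerD b1 b2)).
have -> : e / (2 * (C + 1)) * (C + 1) = e / 2 by field; lra.
have -> : N * (e / (2 * (N + 1))) = e / 2 * (N / (N + 1)) by field; lra.
have : N / (N + 1) <= 1 by rewrite ler_pdivrMr ?mul1r; lra.
nra.
Unshelve. all: by end_near. Qed.

End time_continuity.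

Section joint_continuity.
Context {R : realType}.
Implicit Types (c e : R -> R -> R) (f : R -> R).

Definition continuous2 c := continuous (fun p : R * R => c p.1 p.2).

Lemma continuous2D c e : continuous2 c -> continuous2 e -> continuous2 (fun x t => c x t + e x t).
Proof. by move=> cc ce p; apply: cvgD; [exact: cc|exact: ce]. Qed.

Lemma continuous2B c e : continuous2 c -> continuous2 e -> continuous2 (fun x t => c x t - e x t).
Proof. by move=> cc ce p; apply: cvgB; [exact: cc|exact: ce]. Qed.

Lemma continuous2N c : continuous2 c -> continuous2 (fun x t => - c x t).
Proof. by move=> cc p; apply: cvgN; exact: cc. Qed.

Lemma continuous2M c e : continuous2 c -> continuous2 e -> continuous2 (fun x t => c x t * e x t).
Proof. by move=> cc ce p; apply: cvgM; [exact: cc|exact: ce]. Qed.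

Lemma continuous2_cst (k : R) : continuous2 (fun _ _ => k).
Proof. by move=> p; exact: cvg_cst. Qed.

Lemma continuous2_comp f c : continuous f -> continuous2 c -> continuous2 (fun x t => f (c x t)).
Proof.
move=> cf cc p; apply: (@continuous_comp _ _ _ (fun p : R * R => c p.1 p.2) f); first exact: cc.
exact: cf.
Qed.

Lemma continuous2_fst : continuous2 (fun x _ => x).
Proof. by move=> p; exact: cvg_fst. Qed.

Lemma continuous2_snd : continuous2 (fun _ t => t).
Proof. by move=> p; exact: cvg_snd. Qed.

End joint_continuity.

(** * Passage to the limit under the integral *)

Section limits.
Context {R : realType}.
Notation mu := (@lebesgue_measure R).
Notation I01 := (`[0%R, 1%R]%classic : set R).

Lemma Rintegral_dominated_cvg (D : set R) (f_ : nat -> R -> R) (f g : R -> R) :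
  measurable D -> (forall n, measurable_fun D (f_ n)) -> measurable_fun D f ->
  {ae mu, forall x, D x -> f_ n x @[n --> \oo] --> f x} ->
  mu.-integrable D (EFin \o g) ->
  {ae mu, forall x n, D x -> `|f_ n x| <= g x} ->
  \int[mu]_(x in D) f_ n x @[n --> \oo] --> \int[mu]_(x in D) f x.
Proof.
move=> mD mf_ mf f_f ig f_g.
have [|||||iF _ cvgF] := @dominated_convergence _ _ _ mu D mD
    (fun n => EFin \o f_ n) (EFin \o f) (EFin \o g).
- by move=> n; apply/measurable_EFinP; exact: mf_.
- by apply/measurable_EFinP; exact: mf.
- apply: filterS f_f; first exact: (ae_filter_ringOfSetsType mu).
  by move=> x f_f Dx; apply: cvg_EFin; [exact: nearW|exact: f_f].
- exact: ig.
- apply: filterS f_g; first exact: (ae_filter_ringOfSetsType mu).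
  by move=> x f_g n Dx; rewrite lee_fin; exact: f_g.
apply: fine_cvg; rewrite fineK; last exact: integrable_fin_num.
exact: cvgF.
Qed.

Lemma ae_interior (P : R -> Prop) : (forall x, 0 < x < 1 -> P x) ->
  {ae mu, forall x, I01 x -> P x}.
Proof.
move=> hP; exists ([set 0] `|` [set 1]); split.
- by apply: measurableU; exact: measurable_set1.
- apply: countable_lebesgue_measure0; by apply: finite_set_countable; rewrite finite_setU; split; exact: finite_set1.
- move=> x /= hx; apply: contrapT => /not_orP[x0 x1]; apply: hx => Ix; apply: hP.
  move: Ix; rewrite /= in_itv/= => /andP[x0' x1'].
  by rewrite !lt_neqAle x0' x1' !andbT; apply/andP; split; apply/eqP => // /esym.
Qed.

(** Eventual equality at each interior point is how spatial cutoffs converge; the two end points of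
    [I] form a null set. *)
Lemma pairing_dominated_cvg (f c : R -> R) (c_ : nat -> R -> R) C :
  LinftyI f -> (forall n, continuous (c_ n)) -> continuous c ->
  (forall n x, I01 x -> `|c_ n x| <= C) ->
  (forall x, 0 < x < 1 -> \forall n \near \oo, c_ n x = c x) ->
  \int[mu]_(x in I01) (f x * c_ n x) @[n --> \oo] --> \int[mu]_(x in I01) (f x * c x).
Proof.
move=> fL cc_ cc cC c_c.
have mf : measurable_fun I01 f by have [M _ []] := LinftyI_ae_bounded fL.
apply: (@Rintegral_dominated_cvg _ _ _ (fun x => `|f x| * C)).
- exact: mI01.
- by move=> n; apply: measurable_funM => //; exact: continuous_measurable_I.
- by apply: measurable_funM => //; exact: continuous_measurable_I.
- apply: ae_interior => x x01; apply: cvg_near_cst.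
  by apply: filterS (c_c x x01) => n ->.
- rewrite (_ : _ \o _ = fun x => ((`|f x|)%:E * C%:E)%E); last exact/funext.
  apply: integrableZr; first exact: mI01.
  exact/Rintegral_norm_integrable/Linfty_integrable.
- by apply: aeW => x n Ix; rewrite normrM ler_wpM2l// cC.
Qed.

End limits.

(** * Bounded functions moving continuously in L^1 *)

Section curves.
Context {R : realType}.
Notation mu := (@lebesgue_measure R).
Notation I01 := (`[0%R, 1%R]%classic : set R).
Implicit Types (u c e : R -> R -> R) (t k : R).

Definition Linfty_curve u := (forall t, 0 <= t -> LinftyI (u^~ t)) /\ continuous_L1 u.

Definition pairing u c t := \int[mu]_(x in I01) (u x t * c x t).

Lemma pairing_integrable u c t : Linfty_curve u -> continuous2 c -> 0 <= t ->
  mu.-integrable I01 (EFin \o (fun x => u x t * c x t)).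
Proof.
move=> [uL _] cc t0; apply: (@Linfty_pairing_integrable _ (u^~ t) (c^~ t)); first exact: uL.
exact: continuous_sectionx.
Qed.

Lemma pairingD u c e t : Linfty_curve u -> continuous2 c -> continuous2 e -> 0 <= t ->
  pairing u c t + pairing u e t = pairing u (fun x t => c x t + e x t) t.
Proof.
move=> uc cc ce t0; rewrite /pairing -RintegralD//; [|exact: pairing_integrable..].
by apply: eq_Rintegral => x _; rewrite mulrDr.
Qed.

Lemma pairingZ u c k t : Linfty_curve u -> continuous2 c -> 0 <= t ->
  k * pairing u c t = pairing u (fun x t => k * c x t) t.
Proof.
move=> uc cc t0; rewrite /pairing -RintegralZl//; last exact: pairing_integrable.
by apply: eq_Rintegral => x _; rewrite mulrCA.
Qed.

Lemma pairing_continuous u c t : Linfty_curve u -> continuous2 c -> 0 < t ->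
  {for t, continuous (pairing u c)}.
Proof.
move=> [uL uC] cc t0; have := pairing_cvg uL uC cc (ltW t0).
have t_int : (`[0, +oo[%classic : set R)^° t.
  rewrite /interior; near=> s; rewrite /= in_itv/= andbT ltW//.
  by near: s; exact: lt_nbhsr.
by rewrite (within_interior t_int).
Unshelve. all: by end_near. Qed.

Lemma L1_norm_cvg u t : Linfty_curve u -> 0 <= t ->
  \int[mu]_(x in I01) `|u x s| @[s --> within `[0, +oo[%classic (nbhs t)] -->
  \int[mu]_(x in I01) `|u x t|.
Proof.
move=> [uL uC] t0; apply/cvgrPdist_le => e e0.
have H := L1_dist_near uL uC t0 e0.
have H3 : \forall s \near within `[0, +oo[%classic (nbhs t), 0 <= s.
  by apply: filterS (withinT _ _) => s /=; rewrite in_itv/= andbT.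
near=> s.
have s0 : 0 <= s by near: s.
have hs : \int[mu]_(x in I01) `|u x s - u x t| <= e by near: s.
have i2 r : 0 <= r -> mu.-integrable I01 (EFin \o u^~ r).
  by move=> r0; apply: Linfty_integrable; exact: uL.
have i3 r : 0 <= r -> mu.-integrable I01 (EFin \o (fun x => `|u x r|)).
  by move=> r0; apply: Rintegral_norm_integrable; exact: i2.
have iB (f g : R -> R) : mu.-integrable I01 (EFin \o f) -> mu.-integrable I01 (EFin \o g) ->
    mu.-integrable I01 (EFin \o (fun x => f x - g x)).
  by move=> fi gi; rewrite (_ : _ \o _ = (EFin \o f) \- (EFin \o g))%E; [exact: integrableB|exact/funext].
apply: le_trans hs; rewrite -RintegralB//; [|exact/i3|exact: i3].
apply: le_trans; first by apply: le_normr_Rintegral => //; apply: iB; exact: i3.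
apply: le_Rintegral => //.
- by apply: Rintegral_norm_integrable; apply: iB; exact: i3.
- by apply: Rintegral_norm_integrable; apply: iB; exact: i2.
- by move=> x _; rewrite (le_trans (ler_dist_dist _ _))// distrC.
Unshelve. all: by end_near. Qed.

(** Being essentially bounded at each time gives no bound uniform in time. The L^1 norm does have
    one on compact time intervals, by continuity, and it supplies the majorants below. *)
Lemma L1_norm_bounded u t1 t2 : Linfty_curve u -> 0 <= t1 ->
  exists2 N, 0 <= N & forall t, t1 <= t <= t2 -> \int[mu]_(x in I01) `|u x t| <= N.
Proof.
move=> uc t10; pose N t := \int[mu]_(x in I01) `|u x t|.
have : {within `[t1, t2], continuous N}.
  by apply: within_half_line => // t t0; exact: L1_norm_cvg.
move=> /(@continuous_compact _ _ N `[t1, t2])/(_ (@segment_compact _ _ _)).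
move=> /compact_bounded[M [_ hM]].
exists (`|M| + 1) => [|t tt]; first by rewrite ltW// ltr_wpDl.
apply: le_trans (ler_norm _) _; apply: hM.
  by rewrite (le_lt_trans (ler_norm _))// ltrDl.
by exists t => //=; rewrite in_itv.
Qed.

(** Converts the extended-real integral of the weak formulation into a real one over the time
    support of the test function. *)
Lemma space_time_integral_eq0 (f : R -> R -> R) t1 t2 : 0 < t1 ->
  (forall t, 0 < t -> mu.-integrable I01 (EFin \o f^~ t)) ->
  (forall x t, I01 x -> ~ (t1 <= t <= t2) -> f x t = 0) ->
  (\int[mu]_(t in `]0%R, +oo[) \int[mu]_(x in `[0%R, 1%R]) (f x t)%:E = 0)%E ->
  \int[mu]_(t in `[t1, t2]) \int[mu]_(x in I01) f x t = 0.
Proof.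
move=> t10 fi f0 fE.
have sub : `[t1, t2]%classic `<=` `]0, +oo[%classic.
  by move=> t /=; rewrite !in_itv/= andbT => /andP[+ _]; exact: lt_le_trans.
rewrite /Rintegral; transitivity (fine (0 : \bar R)%E) => //; rewrite -fE; congr fine.
rewrite -[in LHS](setIidr sub) integral_mkcondr; apply: eq_integral => t /set_mem tpos.
rewrite patchE; case: ifPn => [/set_mem tt|/negP tt].
  rewrite fineK//; apply: integrable_fin_num => //; apply: fi.
  by move: tpos; rewrite /= in_itv/= andbT.
apply/esym/integral0_eq => x Ix; rewrite f0// => tt'; apply: tt.
by rewrite inE/= in_itv.
Qed.

End curves.

(** * Spatial cutoffs near the ends of [I] *)

Section cutoff.
Context {R : realType}.
Implicit Types (e x t C : R).

Lemma ramp_itv (t1 e t : R) : 0 <= ramp t1 e t <= 1.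
Proof. exact: smoothstep_itv. Qed.

Lemma dramp_le (t1 e t : R) : 0 < e -> dramp t1 e t <= e^-1.
Proof.
move=> e0; rewrite /dramp ler_piMr ?invr_ge0 ?(ltW e0)//.
by case/andP: (hat_itv (e^-1 * t + - (e^-1 * t1))).
Qed.

(** Each factor rises across the layer between the distances [e] and [3 e] from one end of [I]. *)
Definition cutoff e x := ramp e e x * ramp e e (-1 * x + 1).

Definition dcutoff e x :=
  dramp e e x * ramp e e (-1 * x + 1) - ramp e e x * dramp e e (-1 * x + 1).

Lemma is_derive_cutoff e x : is_derive x 1 (cutoff e) (dcutoff e x).
Proof.
have h := is_derive1_affine (is_derive_ramp e e (-1 * x + 1)).
apply: (is_derive_eq (is_derive1M (is_derive_ramp e e x) h)).
by rewrite /dcutoff; ring.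
Qed.

Lemma continuous_cutoff e : continuous (cutoff e).
Proof. by move=> x; exact: is_derive1_continuous (is_derive_cutoff e x). Qed.

Lemma continuous_dcutoff e : continuous (dcutoff e).
Proof.
have ca (f : R -> R) : continuous f -> continuous (fun x => f (-1 * x + 1)).
  move=> cf x; apply: (@continuous_comp _ _ _ (fun x => -1 * x + 1) f); last exact: cf.
  by apply: cvgD; [apply: cvgM; [exact: cvg_cst|exact: cvg_id]|exact: cvg_cst].
move=> x; apply: cvgB; apply: cvgM.
- exact: continuous_dramp.
- exact/ca/continuous_ramp.
- exact: continuous_ramp.
- exact/ca/continuous_dramp.
Qed.

Lemma cutoff_itv e x : 0 <= cutoff e x <= 1.
Proof.
have /andP[a0 a1] := ramp_itv e e x; have /andP[b0 b1] := ramp_itv e e (-1 * x + 1).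
by rewrite /cutoff mulr_ge0//= mulr_ile1.
Qed.

Lemma cutoff_out e x : 0 < e -> x <= e \/ 1 - e <= x -> cutoff e x = 0.
Proof.
move=> e0 [xe|xe]; rewrite /cutoff; first by rewrite (ramp_le _ xe)// mul0r.
by rewrite [X in _ * X]ramp_le ?mulr0//; lra.
Qed.

Lemma cutoff_in e x : 0 < e -> 3 * e <= x <= 1 - 3 * e -> cutoff e x = 1 /\ dcutoff e x = 0.
Proof.
move=> e0 /andP[ex xe]; rewrite /cutoff /dcutoff.
rewrite !ramp_ge//; [|lra..]; rewrite !dramp_out//; [|right; lra..].
by split; ring.
Qed.

(** The slope is at most [1 / e] and lives where [x] is below [3 e], so that [y] is at most [3 C e]
    there: the powers of [e] cancel. *)
Lemma dramp_mul_le e x y C : 0 < e -> 0 <= x -> 0 <= C -> `|y| <= C * x ->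
  `|dramp e e x * y| <= 3 * C.
Proof.
move=> e0 x0 C0 yC.
have [xe|xe] := leP (e + 2 * e) x.
  by rewrite dramp_out//; [rewrite mul0r normr0; lra|right].
rewrite normrM ger0_norm ?dramp_ge0//.
apply: (@le_trans _ _ (e^-1 * (C * (3 * e)))).
  apply: ler_pM => //; [exact: dramp_ge0|exact: dramp_le|].
  by apply: (le_trans yC); rewrite ler_wpM2l//; lra.
rewrite (_ : e^-1 * _ = 3 * C)//; field; lra.
Qed.

Lemma dcutoff_mul_le e x y C : 0 < e -> 0 <= x <= 1 -> 0 <= C ->
  `|y| <= C * x -> `|y| <= C * (1 - x) -> `|dcutoff e x * y| <= 6 * C.
Proof.
move=> e0 /andP[x0 x1] C0 yC yC'.
have h1 := dramp_mul_le e0 x0 C0 yC.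
have x0' : 0 <= -1 * x + 1 by lra.
have h2 : `|dramp e e (-1 * x + 1) * y| <= 3 * C.
  by apply: dramp_mul_le => //; rewrite (_ : -1 * x + 1 = 1 - x)//; ring.
have /andP[a0 a1] := ramp_itv e e x; have /andP[b0 b1] := ramp_itv e e (-1 * x + 1).
rewrite /dcutoff mulrBl (_ : _ - _ = ramp e e (-1 * x + 1) * (dramp e e x * y) -
  ramp e e x * (dramp e e (-1 * x + 1) * y)); last by ring.
rewrite (le_trans (ler_normB _ _))// normrM (ger0_norm b0) [X in _ + X]normrM (ger0_norm a0).
set u := `|_ * _| in h1 *; set v := `|_ * _| in h2 *.
have u0 : 0 <= u by exact: normr_ge0. 
have v0 : 0 <= v by exact: normr_ge0. 
nra.
Qed.

End cutoff.

(** * From the weak formulation to an integral identity *)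

Section weak_formulation.
Context {R : realType} (d k a b : R) (alpha rho0 J0 : R -> R) (rho J : R -> R -> R).
Notation mu := (@lebesgue_measure R).
Notation I01 := (`[0%R, 1%R]%classic : set R).
Context (sol : weak_solution d alpha rho0 J0 rho J) (a0 : 0 <= a)
  (alphaE : forall t, a < t < b -> alpha t = k).
(** The derivatives prescribed below say that [(p, q)] solves the undamped adjoint system
    [p_t + q_x = 0], [q_t + p_x = 0], so that only the damping survives testing. The bounds [q0] and
    [q1] express that [q] vanishes linearly at both ends of [I]. *)
Context (p q pt px : R -> R -> R) (C : R).
Context (cp : continuous2 p) (cq : continuous2 q) (cpt : continuous2 pt) (cpx : continuous2 px).
Context (dpt : forall x t : R, is_derive t 1 (p x) (pt x t))
        (dpx : forall x t : R, is_derive x 1 (p^~ t) (px x t))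
        (dqt : forall x t : R, is_derive t 1 (q x) (- px x t))
        (dqx : forall x t : R, is_derive x 1 (q^~ t) (- pt x t)).
Context (C0 : 0 <= C) (ptC : forall x t, `|pt x t| <= C) (pxC : forall x t, `|px x t| <= C)
  (q0 : forall x t, I01 x -> `|q x t| <= C * x)
  (q1 : forall x t, I01 x -> `|q x t| <= C * (1 - x)).

Lemma sol_rho : Linfty_curve rho.
Proof. by case: sol => h [cr cJ] _ _ _; split => // t t0; case: (h t t0). Qed.

Lemma sol_J : Linfty_curve J.
Proof. by case: sol => h [cr cJ] _ _ _; split => // t t0; case: (h t t0). Qed.

(** The residuals are the factors of [rho] and [J] left after testing with [p] and [cutoff e * q]
    and using the adjoint system. Inside [I], as [e] tends to [0], the first tends to [0] and the
    second to [- 2 d k q]. *)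
Definition residual_rho e x t := (1 - cutoff e x) * pt x t + dcutoff e x * q x t.
Definition residual_J e x t := (1 - cutoff e x) * px x t - 2 * d * k * (cutoff e x * q x t).

Let cc e : continuous2 (fun x _ : R => cutoff e x).
Proof. exact: (continuous2_comp (@continuous_cutoff _ e) continuous2_fst). Qed.

Let cdc e : continuous2 (fun x _ : R => dcutoff e x).
Proof. exact: (continuous2_comp (@continuous_dcutoff _ e) continuous2_fst). Qed.

Let c1c e : continuous2 (fun x _ : R => 1 - cutoff e x).
Proof. by apply: continuous2B; [exact: continuous2_cst|exact: cc]. Qed.

Lemma continuous2_residual_rho e : continuous2 (residual_rho e).
Proof.
by apply: continuous2D; apply: continuous2M.
Qed.

Lemma continuous2_residual_J e : continuous2 (residual_J e).
Proof.
apply: continuous2B; apply: continuous2M => //; first exact: continuous2_cst.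
exact: continuous2M.
Qed.

Definition pairing_cut e t := pairing rho p t + pairing J (fun x t => cutoff e x * q x t) t.
Definition source_cut e t := pairing rho (residual_rho e) t + pairing J (residual_J e) t.

(** With [th] a difference of two ramps, testing the first equation with [th * p], the second with
    [th * (cutoff e * q)], and adding gives exactly the hypothesis of [du_bois_reymond]. *)
Lemma weak_formulation_cutoff e t1 t2 : 0 < e -> a < t1 -> t1 <= t2 -> t2 < b ->
  pairing_cut e t2 - pairing_cut e t1 = \int[mu]_(t in `[t1, t2]) source_cut e t.
Proof.
move=> e0; move: t1 t2.
have ccq : continuous2 (fun x t => cutoff e x * q x t).
  by apply: continuous2M => //; exact: cc.
apply: (@du_bois_reymond _ a b).
- move=> t; rewrite in_itv/= => /andP[at_ _]; have t0 := le_lt_trans a0 at_.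
  by apply: cvgD; apply: pairing_continuous => //; [exact: sol_rho|exact: sol_J].
- move=> t; rewrite in_itv/= => /andP[at_ _]; have t0 := le_lt_trans a0 at_.
  apply: cvgD; apply: pairing_continuous => //;
    [exact: sol_rho|exact: continuous2_residual_rho|exact: sol_J|exact: continuous2_residual_J].
move=> t1 t2 h at1 t12 h0; set T := t2 + 2 * h => Tb.
have t10 := le_lt_trans a0 at1.
pose th t := ramp t1 h t - ramp t2 h t; pose dth t := dramp t1 h t - dramp t2 h t.
have dthE (t : R) : is_derive t 1 th (dth t) by apply: is_derive1B; exact: is_derive_ramp.
have cth : continuous th by move=> t; exact: is_derive1_continuous (dthE t).
have cdth : continuous dth by move=> t; apply: cvgB; exact: continuous_dramp.
have th0 t : ~ (t1 <= t <= T) -> th t = 0.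
  move=> /negP; rewrite negb_and -!ltNge => /orP[tt|tt]; rewrite /th.
    by rewrite !ramp_le ?subrr//; lra.
  have ? : t2 + 2 * h < t by [].
  by rewrite !ramp_ge ?subrr//; lra.
have c2th : continuous2 (fun _ t : R => th t) by exact: (continuous2_comp cth continuous2_snd).
have c2dth : continuous2 (fun _ t : R => dth t) by exact: (continuous2_comp cdth continuous2_snd).
pose f1 x t := th t * p x t.
pose f1t x t := dth t * p x t + th t * pt x t.
pose f1x x t := th t * px x t.
pose f2 x t := th t * (cutoff e x * q x t).
pose f2t x t := dth t * (cutoff e x * q x t) - th t * (cutoff e x * px x t).
pose f2x x t := th t * (dcutoff e x * q x t - cutoff e x * pt x t).
have cf1 : continuous2 f1 by exact: continuous2M.
have cf1t : continuous2 f1t by apply: continuous2D; exact: continuous2M.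
have cf1x : continuous2 f1x by exact: continuous2M.
have cf2 : continuous2 f2 by exact: continuous2M.
have cf2t : continuous2 f2t.
  by apply: continuous2B; apply: continuous2M => //; apply: continuous2M => //; exact: cc.
have cf2x : continuous2 f2x.
  by apply: continuous2M => //; apply: continuous2B; apply: continuous2M.
have test1 : test_function I01 f1 f1t f1x.
  split.
  - exact: continuous_subspaceT.
  - exact: continuous_subspaceT.
  - exact: continuous_subspaceT.
  - move=> x t _ _; split; first exact: (is_derive1M (dthE t) (dpt x t)).
    exact: (is_derive1Z (th t) (dpx x t)).
  - exists (I01 `*` `[t1, T]); split.
    + by apply: compact_setX; exact: segment_compact.
    + move=> [x t] /= [Ix tt]; split => //; move: tt; rewrite /= !in_itv/= andbT.
      by move=> /andP[tt _]; exact: lt_le_trans tt.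
    + move=> x t [Ix _] nK; rewrite /f1 th0 ?mul0r// => tt; apply: nK.
      by split => //=; rewrite in_itv.
have test2 : test_function `]0, 1[%classic f2 f2t f2x.
  split.
  - exact: continuous_subspaceT.
  - exact: continuous_subspaceT.
  - exact: continuous_subspaceT.
  - move=> x t _ _; split.
      apply: (is_derive_eq (is_derive1M (dthE t) (is_derive1Z (cutoff e x) (dqt x t)))).
      by rewrite /f2t; ring.
    apply: (is_derive_eq (is_derive1Z (th t) (is_derive1M (is_derive_cutoff e x) (dqx x t)))).
    by rewrite /f2x; ring.
  (* Here the cutoff does its work: it vanishes outside [[e, 1 - e]], a compact part of the open
     interval. *)
  - exists (`[e, 1 - e] `*` `[t1, T]); split.
    + by apply: compact_setX; exact: segment_compact.
    + move=> [x t] /= [Ix tt]; split => //=; move: tt Ix; rewrite /= !in_itv/= ?andbT.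
        by move=> _ /andP[? ?]; lra.
      by move=> /andP[? _] _; lra.
    + move=> x t [Ix _] nK; rewrite /f2.
      have [xe|xe] := leP x e; first by rewrite cutoff_out ?mul0r ?mulr0//; left.
      have [xe'|xe'] := leP (1 - e) x; first by rewrite cutoff_out ?mul0r ?mulr0//; right.
      rewrite th0 ?mul0r// => tt; apply: nK.
      by split => /=; rewrite in_itv//= (ltW xe) (ltW xe').
have [_ _ _ w1 w2] := sol.
have {w1} := w1 _ _ _ test1; have {w2} := w2 _ _ _ test2.
pose g1 x t := rho x t * f1t x t + J x t * f1x x t.
pose g2 x t := J x t * f2t x t + rho x t * f2x x t - 2 * d * alpha t * J x t * f2 x t.
have crho := sol_rho; have cJ := sol_J.
have ir c t : continuous2 c -> 0 < t -> mu.-integrable I01 (EFin \o (fun x => rho x t * c x t)).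
  by move=> cc' t0; apply: pairing_integrable => //; exact: ltW.
have iJ c t : continuous2 c -> 0 < t -> mu.-integrable I01 (EFin \o (fun x => J x t * c x t)).
  by move=> cc' t0; apply: pairing_integrable => //; exact: ltW.
have iD (f g : R -> R) : mu.-integrable I01 (EFin \o f) -> mu.-integrable I01 (EFin \o g) ->
    mu.-integrable I01 (EFin \o (fun x => f x + g x)).
  by move=> fi gi; rewrite (_ : _ \o _ = (EFin \o f) \+ (EFin \o g))%E; [exact: integrableD|exact/funext].
pose f3 x t := f2t x t - 2 * d * k * f2 x t.
have cf3 : continuous2 f3.
  by apply: continuous2B => //; apply: continuous2M => //; exact: continuous2_cst.
(* The support of [th] lies in []a, b[], where [alpha] is [k]; the damping term thus becomes a
   pairing with a continuous function. *)
have alE t : alpha t * th t = k * th t.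
  have [tt|tt] := pselect (t1 <= t <= T); last by rewrite th0// !mulr0.
  by rewrite alphaE//; case/andP: tt => ? ?; lra.
have g2E x t : g2 x t = J x t * f3 x t + rho x t * f2x x t.
  transitivity (J x t * f2t x t + rho x t * f2x x t -
    2 * d * (alpha t * th t) * J x t * (cutoff e x * q x t)).
    by rewrite /g2 /f2; ring.
  by rewrite alE /f3 /f2; ring.
have Ddth t : ~ (t1 <= t <= T) -> dth t = 0.
  move=> /negP; rewrite negb_and -!ltNge => /orP[tt|tt]; rewrite /dth.
    by rewrite !dramp_out ?subrr//; left; lra.
  have ? : t2 + 2 * h < t by [].
  by rewrite !dramp_out ?subrr//; right; lra.
move=> /(@space_time_integral_eq0 _ g2 t1 T t10) W2.
move=> /(@space_time_integral_eq0 _ g1 t1 T t10) W1.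
have {}W1 : \int[mu]_(t in `[t1, T]) (pairing rho f1t t + pairing J f1x t) = 0.
  rewrite -W1.
  - apply: eq_Rintegral => t /set_mem/=; rewrite in_itv/= => /andP[tt _].
    by rewrite /pairing -RintegralD//; [apply: ir => //|apply: iJ => //]; lra.
  - by move=> t t0; apply: iD; [exact: ir|exact: iJ].
  - by move=> x t _ tt; rewrite /g1 /f1t /f1x th0// Ddth// !mul0r addr0 !mulr0 addr0.
have {}W2 : \int[mu]_(t in `[t1, T]) (pairing J f3 t + pairing rho f2x t) = 0.
  rewrite -W2.
  - apply: eq_Rintegral => t /set_mem/=; rewrite in_itv/= => /andP[tt _].
    rewrite /pairing -RintegralD//; [|by apply: iJ => //; lra|by apply: ir => //; lra].
    by apply: eq_Rintegral => x _; rewrite -g2E.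
  - move=> t t0; rewrite (_ : g2^~ t = fun x => J x t * f3 x t + rho x t * f2x x t); last first.
      by apply/funext => x; rewrite g2E.
    by apply: iD; [exact: iJ|exact: ir].
  - by move=> x t _ tt; rewrite g2E /f3 /f2 /f2t /f2x th0// Ddth//; ring.
have Ttt : {in `[t1, T]%classic, forall t, 0 < t}.
  by move=> t; rewrite inE/= in_itv/= => /andP[tt _]; lra.
have cw (u c : R -> R -> R) : Linfty_curve u -> continuous2 c ->
    {within `[t1, T], continuous (pairing u c)}.
  move=> cu cc'; apply: continuous_in_subspaceT => t /Ttt t0.
  exact: pairing_continuous.
transitivity (\int[mu]_(t in `[t1, T]) (pairing rho f1t t + pairing J f1x t) +
              \int[mu]_(t in `[t1, T]) (pairing J f3 t + pairing rho f2x t)); last first.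
  by rewrite W1 W2 addr0.
rewrite -RintegralD//; [|by apply: within_itv_integrable; apply: within_itvD; exact: cw..].
apply: eq_Rintegral => t /Ttt t0; have t0' := ltW t0.
rewrite /pairing_cut /source_cut -/(th t) -/(dth t) !mulrDr.
have c2k u (c : R -> R -> R) : continuous2 c -> continuous2 (fun x s => u * c x s).
  by move=> c2c; apply: continuous2M => //; exact: continuous2_cst.
have cwp := @continuous2_residual_rho e; have cwJ := @continuous2_residual_J e.
rewrite !pairingZ// addrACA [X in _ = _ + X]addrC [RHS]addrACA.
rewrite !pairingD//; [|exact: c2k..].
congr (_ + _); apply: eq_Rintegral => x _; congr (_ * _).
  by rewrite /f1t /f2x /residual_rho -/(th t); ring.
by rewrite /f1x /f3 /f2 /f2t /residual_J -/(th t); ring.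
Qed.


Let en (n : nat) : R := n.+1%:R^-1.

Let en_gt0 n : 0 < en n. Proof. by rewrite invr_gt0. Qed.

Let cutoff_near (x : R) : 0 < x < 1 ->
  \forall n \near \oo, cutoff (en n) x = 1 /\ dcutoff (en n) x = 0.
Proof.
move=> /andP[x0 x1].
have m0 : 0 < Num.min x (1 - x) / 3 by rewrite divr_gt0// lt_min x0 subr_gt0.
near=> n; apply: cutoff_in => //.
have : en n < Num.min x (1 - x) / 3.
  by near: n; exact: (near_infty_natSinv_lt (PosNum m0)).
by rewrite ltr_pdivlMr// lt_min => /andP[? ?]; apply/andP; split; lra.
Unshelve. all: by end_near. Qed.

Let qC x t : I01 x -> `|q x t| <= C.
Proof.
move=> Ix; apply: le_trans (q0 t Ix) _; move: Ix; rewrite /= in_itv/= => /andP[_ x1].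
by rewrite ler_piMr.
Qed.

Let cutoffM_le e x (y : R) : `|y| <= C -> `|cutoff e x * y| <= C.
Proof.
move=> yC; have /andP[c0 c1] := cutoff_itv e x.
by rewrite normrM ger0_norm// (le_trans _ yC)// ler_piMl.
Qed.

Let cutoff1M_le e x (y : R) : `|y| <= C -> `|(1 - cutoff e x) * y| <= C.
Proof.
move=> yC; have /andP[c0 c1] := cutoff_itv e x.
rewrite normrM ger0_norm; last by lra.
by rewrite (le_trans _ yC)// ler_piMl//; lra.
Qed.

(** One [C] comes from the first term and [6 * C] from the two boundary layers, where the linear
    vanishing of [q] offsets the slope of the cutoff. The bound is free of [e]. *)
Let residual_rho_le e x t : 0 < e -> I01 x -> `|residual_rho e x t| <= 7 * C.
Proof.
move=> e0 Ix; rewrite /residual_rho (le_trans (ler_normD _ _))//.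
have h1 : `|(1 - cutoff e x) * pt x t| <= C by exact: cutoff1M_le.
have h2 : `|dcutoff e x * q x t| <= 6 * C.
  by apply: dcutoff_mul_le => //; [exact: q0|exact: q1].
lra.
Qed.

Let residual_J_le e x t : 0 < e -> I01 x -> `|residual_J e x t| <= C + `|2 * d * k| * C.
Proof.
move=> e0 Ix; rewrite /residual_J (le_trans (ler_normB _ _))// lerD//; first exact: cutoff1M_le.
by rewrite normrM ler_wpM2l// cutoffM_le// qC.
Qed.

(** The cutoff is removed by dominated convergence used twice: in space at each fixed time, then in
    time. *)
Lemma weak_formulation_limit t1 t2 : a < t1 -> t1 <= t2 -> t2 < b ->
  (pairing rho p t2 + pairing J q t2) - (pairing rho p t1 + pairing J q t1) =
  \int[mu]_(t in `[t1, t2]) (- (2 * d * k) * pairing J q t).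
Proof.
move=> at1 t12 t2b; have t10 := le_lt_trans a0 at1.
have crho := sol_rho; have cJ := sol_J.
have cvgJ t : 0 < t -> pairing_cut (en n) t @[n --> \oo] --> pairing rho p t + pairing J q t.
  move=> t0; apply: cvgD; first exact: cvg_cst.
  apply: (@pairing_dominated_cvg _ (J^~ t) (q^~ t) (fun n x => cutoff (en n) x * q x t) C).
  - by case: cJ => + _; apply; exact: ltW.
  - move=> n; apply: (@continuous_sectionx _ (fun x t => cutoff (en n) x * q x t)).
    exact: (continuous2M (@cc (en n)) cq).
  - exact: (@continuous_sectionx _ q).
  - by move=> n x Ix; rewrite cutoffM_le// qC.
  - by move=> x /cutoff_near; apply: filterS => n [-> _]; rewrite mul1r.
have cvgS t : 0 < t ->
    source_cut (en n) t @[n --> \oo] --> - (2 * d * k) * pairing J q t.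
  move=> t0; rewrite pairingZ//; last exact: ltW.
  (* A zero pairing with [rho] is added so that the two terms of [source_cut] can converge
     separately. *)
  have -> : pairing J (fun x t => - (2 * d * k) * q x t) t =
      pairing rho (fun _ _ => 0) t + pairing J (fun x t => - (2 * d * k) * q x t) t.
    rewrite [X in _ = X + _](_ : _ = 0) ?add0r// /pairing.
    under eq_Rintegral do rewrite mulr0.
    by rewrite Rintegral_cst ?mul0r//; exact: mI01.
  apply: cvgD.
  - apply: (@pairing_dominated_cvg _ (rho^~ t) (fun=> 0) (fun n x => residual_rho (en n) x t) (7 * C)).
    + by case: crho => + _; apply; exact: ltW.
    + by move=> n; apply: (@continuous_sectionx _ (residual_rho (en n))); exact: continuous2_residual_rho.
    + by move=> x; exact: cvg_cst.
    + by move=> n x Ix; exact: residual_rho_le.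
    + move=> x /cutoff_near; apply: filterS => n [E1 E2].
      by rewrite /residual_rho E1 E2; ring.
  - apply: (@pairing_dominated_cvg _ (J^~ t) (fun x => - (2 * d * k) * q x t)
      (fun n x => residual_J (en n) x t) (C + `|2 * d * k| * C)).
    + by case: cJ => + _; apply; exact: ltW.
    + by move=> n; apply: (@continuous_sectionx _ (residual_J (en n))); exact: continuous2_residual_J.
    + apply: (@continuous_sectionx _ (fun x t => - (2 * d * k) * q x t)).
      exact: (continuous2M (@continuous2_cst _ (- (2 * d * k))) cq).
    + by move=> n x Ix; exact: residual_J_le.
    + move=> x /cutoff_near; apply: filterS => n [E1 E2].
      by rewrite /residual_J E1; ring.
have [N1 N10 hN1] := L1_norm_bounded t2 crho (ltW t10).
have [N2 N20 hN2] := L1_norm_bounded t2 cJ (ltW t10).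
have tpos t : `[t1, t2]%classic t -> 0 < t.
  by rewrite /= in_itv/= => /andP[tt _]; exact: lt_le_trans tt.
have cpos (f : R -> R) : (forall t, 0 < t -> {for t, continuous f}) ->
    {within `[t1, t2], continuous f}.
  by move=> cf; apply: continuous_in_subspaceT => t /set_mem/tpos/cf.
have csrc e : {within `[t1, t2], continuous (source_cut e)}.
  apply: cpos => t t0; apply: cvgD; apply: pairing_continuous => //;
    [exact: continuous2_residual_rho|exact: continuous2_residual_J].
have clim : {within `[t1, t2], continuous (fun t => - (2 * d * k) * pairing J q t)}.
  apply: cpos => t t0; apply: cvgM; first exact: cvg_cst.
  exact: pairing_continuous.
(* L^1 bounds of the solution on [[t1, t2]] times sup bounds of the residuals: a majorant constant
   in time and independent of [n]. *)
pose K := N1 * (7 * C) + N2 * (C + `|2 * d * k| * C).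
have lim1 : \int[mu]_(t in `[t1, t2]) source_cut (en n) t @[n --> \oo] -->
    \int[mu]_(t in `[t1, t2]) (- (2 * d * k) * pairing J q t).
  apply: (@Rintegral_dominated_cvg _ _ _ _ (fun=> K)).
  - exact: measurable_itv.
  - move=> n; have /(within_itv_integrable (b := t2)) := csrc (en n).
    by move=> /measurable_int/measurable_EFinP.
  - by have /(within_itv_integrable (b := t2))/measurable_int/measurable_EFinP := clim.
  - by apply: aeW => t /tpos; exact: cvgS.
  - by apply: within_itv_integrable; apply: continuous_subspaceT => t; exact: cvg_cst.
  - apply: aeW => t n tt; have t0 := tpos _ tt; move: tt; rewrite /= in_itv/= => tt.
    rewrite /source_cut (le_trans (ler_normD _ _))// lerD//.
    + apply: (@le_trans _ _ (\int[mu]_(x in I01) `|rho x t| * (7 * C))).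
        apply: (@pairing_le_L1 _ (rho^~ t) (fun x => residual_rho (en n) x t)).
        * by apply: Linfty_integrable; case: crho => + _; apply; exact: ltW.
        * by apply: (@pairing_integrable _ rho (residual_rho (en n))) => //; [exact: continuous2_residual_rho|exact: ltW].
        * by move=> x Ix; exact: residual_rho_le.
      by rewrite ler_wpM2r ?hN1// mulr_ge0.
    + apply: (@le_trans _ _ (\int[mu]_(x in I01) `|J x t| * (C + `|2 * d * k| * C))).
        apply: (@pairing_le_L1 _ (J^~ t) (fun x => residual_J (en n) x t)).
        * by apply: Linfty_integrable; case: cJ => + _; apply; exact: ltW.
        * by apply: (@pairing_integrable _ J (residual_J (en n))) => //; [exact: continuous2_residual_J|exact: ltW].
        * by move=> x Ix; exact: residual_J_le.
      by rewrite ler_wpM2r ?hN2// addr_ge0// mulr_ge0.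
have t20 := lt_le_trans t10 t12.
have lim2 : \int[mu]_(t in `[t1, t2]) source_cut (en n) t @[n --> \oo] -->
    (pairing rho p t2 + pairing J q t2) - (pairing rho p t1 + pairing J q t1).
  rewrite (_ : (fun n => _) = fun n => pairing_cut (en n) t2 - pairing_cut (en n) t1).
    by apply: cvgB; exact: cvgJ.
  by apply/funext => n; rewrite -weak_formulation_cutoff.
by rewrite -(cvg_lim _ lim2)// -(cvg_lim _ lim1).
Qed.

End weak_formulation.

Section continuity_from_0.
Context {R : realType}.
Notation mu := (@lebesgue_measure R).
Notation I01 := (`[0%R, 1%R]%classic : set R).
Implicit Types (u c : R -> R -> R) (f : R -> R) (a b t : R).

Lemma pairing_within_continuous u c a b : Linfty_curve u -> continuous2 c -> 0 <= a ->
  {within `[a, b], continuous (pairing u c)}.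
Proof.
move=> [uL uC] cc a0; apply: within_half_line => // t t0.
exact: (pairing_cvg uL uC cc t0).
Qed.

End continuity_from_0.

(** * The equation along characteristics *)

Section characteristics.
Context {R : realType}.
Notation mu := (@lebesgue_measure R).
Notation I01 := (`[0%R, 1%R]%classic : set R).
Implicit Types (psi dpsi : R -> R) (x y z t C : R).

Definition is_kernel psi dpsi C :=
  [/\ forall x, is_derive x 1 psi (dpsi x), continuous dpsi,
      forall x, `|psi x| <= C /\ `|dpsi x| <= C,
      forall x, psi (- x) = psi x & forall x, psi (x + 2) = psi x].

(** The even and odd parts in [x] of the translate of [psi] by [z]. Folding the circle onto [I], the
    even part meets [G (x) + G (- x)], which is [rho], and the odd part meets [G (x) - G (- x)],
    which is [J]. *)
Definition even_part psi z x := (psi (x - z) + psi (- x - z)) / 2.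
Definition odd_part psi z x := (psi (x - z) - psi (- x - z)) / 2.

(* The convolution at [z] of [psi] with the function [G] on the circle. *)
Definition smoothed (rho J : R -> R -> R) psi z t :=
  pairing rho (fun x _ => even_part psi z x) t + pairing J (fun x _ => odd_part psi z x) t.

Lemma is_derive_affine_comp (f df : R -> R) (g : R -> R) x k c :
  (forall y, is_derive y 1 f (df y)) -> (forall y, g y = k * y + c) ->
  is_derive x 1 (fun y => f (g y)) (k * df (g x)).
Proof.
move=> dff gE; rewrite (_ : (fun y => _) = fun y => f (k * y + c)); last first.
  by apply/funext => y; rewrite gE.
by rewrite gE; exact: is_derive1_affine.
Qed.

Lemma bounded_derive_lipschitz (f df : R -> R) C : (forall y, is_derive y 1 f (df y)) ->
  (forall y, `|df y| <= C) -> forall x y, `|f x - f y| <= C * `|x - y|.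
Proof.
move=> dff dfC.
have cf : continuous f by move=> x; exact: is_derive1_continuous (dff x).
have main x y : x <= y -> `|f y - f x| <= C * `|y - x|.
  move=> xy; have [|c _ ->] := @MVT_segment _ f df x y xy.
    exact: continuous_subspaceT.
  by rewrite normrM ler_wpM2r.
move=> x y; have [xy|/ltW xy] := leP x y; last exact: main.
by rewrite distrC (distrC x); exact: main.
Qed.

Lemma kernel_continuous psi dpsi C : is_kernel psi dpsi C -> continuous psi.
Proof. by move=> [dp _ _ _ _] x; exact: is_derive1_continuous (dp x). Qed.

Lemma kernel_ge0 psi dpsi C : is_kernel psi dpsi C -> 0 <= C.
Proof. by move=> [_ _ /(_ 0)[h _] _ _]; exact: le_trans h. Qed.

Section with_kernel.
Context (psi dpsi : R -> R) (C : R) (hpsi : is_kernel psi dpsi C).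

Lemma continuous2_even_part (z : R -> R) : continuous z ->
  continuous2 (fun x t => even_part psi (z t) x).
Proof.
move=> cz; have cp := kernel_continuous hpsi.
have c2z := continuous2_comp cz (@continuous2_snd R).
apply: (continuous2M _ (@continuous2_cst R 2^-1)).
apply: continuous2D; apply: (continuous2_comp cp).
  exact: (continuous2B (@continuous2_fst R) c2z).
exact: (continuous2B (continuous2N (@continuous2_fst R)) c2z).
Qed.

Lemma continuous2_odd_part (z : R -> R) : continuous z ->
  continuous2 (fun x t => odd_part psi (z t) x).
Proof.
move=> cz; have cp := kernel_continuous hpsi.
have c2z := continuous2_comp cz (@continuous2_snd R).
apply: (continuous2M _ (@continuous2_cst R 2^-1)).
apply: continuous2B; apply: (continuous2_comp cp).
  exact: (continuous2B (@continuous2_fst R) c2z).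
exact: (continuous2B (continuous2N (@continuous2_fst R)) c2z).
Qed.

Context (d k a b : R) (alpha rho0 J0 : R -> R) (rho J : R -> R -> R).
Context (sol : weak_solution d alpha rho0 J0 rho J) (a0 : 0 <= a)
  (alphaE : forall t, a < t < b -> alpha t = k).

Local Notation u := (smoothed rho J psi).

(** Since [psi] is even, [z |-> - z] keeps the even part and changes the sign of the odd one, so the
    difference isolates [J]. This is what identifies the damping term with reflection. *)
Lemma smoothed_opp z t : 0 <= t -> u (- z) t - u z t =
  - 2 * pairing J (fun x _ => odd_part psi z x) t.
Proof.
move=> t0; case: hpsi => _ _ _ ev _; have cJ := sol_J sol.
have c1 : continuous2 (fun x t : R => odd_part psi z x).
  by apply: (@continuous2_odd_part (fun=> z)) => s; exact: cvg_cst.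
have e1 x : odd_part psi (- z) x = -1 * odd_part psi z x.
  rewrite /odd_part -(ev (x - z)) -(ev (- x - z)) (_ : - (x - z) = - x - - z); last by ring.
  by rewrite (_ : - (- x - z) = x - - z); [ring|ring].
have e2 x : even_part psi (- z) x = even_part psi z x.
  rewrite /even_part -(ev (x - z)) -(ev (- x - z)) (_ : - (x - z) = - x - - z); last by ring.
  by rewrite (_ : - (- x - z) = x - - z); [ring|ring].
rewrite /smoothed.
rewrite (_ : (fun x _ : R => even_part psi (- z) x) = fun x _ => even_part psi z x); last first.
  by apply/funext => x; rewrite e2.
rewrite (_ : (fun x _ : R => odd_part psi (- z) x) = fun x _ => -1 * odd_part psi z x); last first.
  by apply/funext => x; rewrite e1.
by rewrite -(pairingZ _ cJ c1 t0); ring.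
Qed.

(** When the centre moves with speed one, the even and odd parts of the kernel solve the undamped
    adjoint system, so [weak_formulation_limit] applies to them. *)
Lemma smoothed_characteristic_integral y t1 t2 : a < t1 -> t1 <= t2 -> t2 < b ->
  u (y + t2) t2 - u (y + t1) t1 =
  \int[mu]_(t in `[t1, t2]) (d * k * (u (- (y + t)) t - u (y + t) t)).
Proof.
move=> at1 t12 t2b; case: (hpsi) => dp cdp bp ev per.
have C0 := kernel_ge0 hpsi.
have cs : continuous (fun t : R => y + t).
  by move=> t; apply: cvgD; [exact: cvg_cst|exact: cvg_id].
pose p x t := even_part psi (y + t) x; pose q x t := odd_part psi (y + t) x.
pose pt x t := - (dpsi (x - (y + t)) + dpsi (- x - (y + t))) / 2.
pose px x t := (dpsi (x - (y + t)) - dpsi (- x - (y + t))) / 2.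
have cp : continuous2 p by exact: continuous2_even_part.
have cq : continuous2 q by exact: continuous2_odd_part.
have cd1 : continuous2 (fun x t => dpsi (x - (y + t))).
  apply: (continuous2_comp cdp).
  exact: (continuous2B (@continuous2_fst R) (continuous2_comp cs (@continuous2_snd R))).
have cd2 : continuous2 (fun x t => dpsi (- x - (y + t))).
  apply: (continuous2_comp cdp).
  exact: (continuous2B (continuous2N (@continuous2_fst R)) (continuous2_comp cs (@continuous2_snd R))).
have cpt : continuous2 pt.
  exact: (continuous2M (continuous2N (continuous2D cd1 cd2)) (@continuous2_cst R 2^-1)).
have cpx : continuous2 px.
  exact: (continuous2M (continuous2B cd1 cd2) (@continuous2_cst R 2^-1)).
have Dt1 (x t : R) : is_derive t 1 (fun t => psi (x - (y + t))) (-1 * dpsi (x - (y + t))).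
  by apply: (@is_derive_affine_comp _ _ (fun t => x - (y + t)) _ _ (x - y) dp) => s; ring.
have Dt2 (x t : R) : is_derive t 1 (fun t => psi (- x - (y + t))) (-1 * dpsi (- x - (y + t))).
  by apply: (@is_derive_affine_comp _ _ (fun t => - x - (y + t)) _ _ (- x - y) dp) => s; ring.
have Dx1 (x t : R) : is_derive x 1 (fun x => psi (x - (y + t))) (1 * dpsi (x - (y + t))).
  by apply: (@is_derive_affine_comp _ _ (fun x => x - (y + t)) _ _ (- (y + t)) dp) => s; ring.
have Dx2 (x t : R) : is_derive x 1 (fun x => psi (- x - (y + t))) (-1 * dpsi (- x - (y + t))).
  by apply: (@is_derive_affine_comp _ _ (fun x => - x - (y + t)) _ _ (- (y + t)) dp) => s; ring.
have half (f : R -> R) (x c c' : R) : is_derive x 1 f c -> 2^-1 * c = c' ->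
    is_derive x 1 (fun y => f y / 2) c'.
  move=> df <-; rewrite (_ : (fun y => _) = fun y => 2^-1 * f y); first exact: is_derive1Z.
  by apply/funext => z; rewrite mulrC.
have D1 (x t : R) : is_derive t 1 (p x) (pt x t).
  by apply: (half _ _ _ _ (is_derive1D (Dt1 x t) (Dt2 x t))); rewrite /pt; ring.
have D2 (x t : R) : is_derive x 1 (p^~ t) (px x t).
  by apply: (half _ _ _ _ (is_derive1D (Dx1 x t) (Dx2 x t))); rewrite /px; ring.
have D3 (x t : R) : is_derive t 1 (q x) (- px x t).
  by apply: (half _ _ _ _ (is_derive1B (Dt1 x t) (Dt2 x t))); rewrite /px; ring.
have D4 (x t : R) : is_derive x 1 (q^~ t) (- pt x t).
  by apply: (half _ _ _ _ (is_derive1B (Dx1 x t) (Dx2 x t))); rewrite /pt; ring.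
have B1 (x t : R) : `|pt x t| <= C.
  have [_ h1] := bp (x - (y + t)); have [_ h2] := bp (- x - (y + t)).
  by move: h1 h2; rewrite /pt !ler_norml => /andP[? ?] /andP[? ?]; apply/andP; split; lra.
have B2 (x t : R) : `|px x t| <= C.
  have [_ h1] := bp (x - (y + t)); have [_ h2] := bp (- x - (y + t)).
  by move: h1 h2; rewrite /px !ler_norml => /andP[? ?] /andP[? ?]; apply/andP; split; lra.
have lip := bounded_derive_lipschitz dp (fun z => (bp z).2).
have B3 (x t : R) : I01 x -> `|q x t| <= C * x.
  (* The arguments [x - (y + t)] and [- x - (y + t)] are [2 x] apart. For the other end of [I],
     shifting one of them by the period makes them [2 (1 - x)] apart. *)
  rewrite /= in_itv/= => /andP[x0 x1].
  have := lip (x - (y + t)) (- x - (y + t)).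
  rewrite (_ : x - (y + t) - _ = 2 * x); last by ring.
  rewrite (ger0_norm (_ : 0 <= 2 * x)); last by lra.
  by rewrite /q /odd_part !ler_norml => /andP[? ?]; apply/andP; split; lra.
have B4 (x t : R) : I01 x -> `|q x t| <= C * (1 - x).
  rewrite /= in_itv/= => /andP[x0 x1].
  have := lip (- x - (y + t) + 2) (x - (y + t)).
  rewrite (_ : _ + 2 - _ = 2 * (1 - x)); last by ring.
  rewrite (ger0_norm (_ : 0 <= 2 * (1 - x))); last by lra.
  by rewrite per /q /odd_part !ler_norml => /andP[? ?]; apply/andP; split; lra.
have W := weak_formulation_limit sol a0 alphaE cp cq cpt cpx D1 D2 D3 D4 C0 B1 B2 B3 B4 at1 t12 t2b.
have uE t : u (y + t) t = pairing rho p t + pairing J q t by [].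
rewrite !uE W; apply: eq_Rintegral => t /set_mem; rewrite /= in_itv/= => /andP[tt _].
have t0 : 0 <= t by exact: le_trans (ltW (le_lt_trans a0 at1)) tt.
have -> : d * k * (u (- (y + t)) t - u (y + t) t) = d * k * (-2 * pairing J q t).
  by congr (_ * _); exact: smoothed_opp.
by ring.
Qed.

Lemma smoothed_within_continuous (z : R -> R) s1 s2 : continuous z -> 0 <= s1 ->
  {within `[s1, s2], continuous (fun t => u (z t) t)}.
Proof.
move=> cz s10 x; apply: cvgD.
  apply: (@pairing_within_continuous _ rho (fun x t => even_part psi (z t) x)) => //.
    exact: (sol_rho sol).
  exact: continuous2_even_part.
apply: (@pairing_within_continuous _ J (fun x t => odd_part psi (z t) x)) => //.
  exact: (sol_J sol).
exact: continuous2_odd_part.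
Qed.

Lemma smoothed_continuous (z : R -> R) t : continuous z -> 0 < t ->
  {for t, continuous (fun t => u (z t) t)}.
Proof.
move=> cz t0; apply: cvgD.
  apply: (@pairing_continuous _ rho (fun x t => even_part psi (z t) x)) => //.
    exact: (sol_rho sol).
  exact: continuous2_even_part.
apply: (@pairing_continuous _ J (fun x t => odd_part psi (z t) x)) => //.
  exact: (sol_J sol).
exact: continuous2_odd_part.
Qed.

(** The integrand of the integral identity is continuous in time, so the identity may be
    differentiated at interior times. *)
Lemma is_derive_smoothed_characteristic y t : a < t < b ->
  is_derive t 1 (fun t => u (y + t) t) (d * k * (u (- (y + t)) t - u (y + t) t)).
Proof.
move=> /andP[at_ tb].
have cs : continuous (fun t : R => y + t).
  by move=> s; apply: cvgD; [exact: cvg_cst|exact: cvg_id].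
have cs' : continuous (fun t : R => - (y + t)) by move=> s; apply: cvgN; exact: cs.
pose B t := d * k * (u (- (y + t)) t - u (y + t) t).
have cB : {in `]a, b[%R, continuous B}.
  move=> s; rewrite in_itv/= => /andP[as_ _]; have s0 := le_lt_trans a0 as_.
  apply: cvgM; first exact: cvg_cst.
  by apply: cvgB; [exact: (smoothed_continuous cs')|exact: (smoothed_continuous cs)].
pose c := (a + t) / 2.
have ac : a < c by rewrite /c; lra.
have ct : c < t by rewrite /c; lra.
apply: (@near_eq_is_derive _ _ _
    (fun s => u (y + c) c + \int[mu]_(r in `[c, s]) B r)).
  near=> s; rewrite -smoothed_characteristic_integral//.
  - ring.
  - by apply/ltW; near: s; exact: lt_nbhsr.
  - by near: s; exact: lt_nbhsl.
apply: (is_derive_eq (is_derive1D (is_derive_cst (u (y + c) c) t 1)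
  (is_derive_primitive cB ac ct tb))).
by rewrite add0r.
Unshelve. all: by end_near. Qed.

End with_kernel.
End characteristics.

(** * Comparison of functions through their derivatives *)

Section comparison.
Context {R : realType}.
Implicit Types (f df g dg : R -> R) (a b : R).

(** Both [g - f] and [g + f] are nondecreasing, by the mean value theorem. *)
Lemma derive_dominated_le f df g dg a b : a <= b ->
  {within `[a, b], continuous f} -> {within `[a, b], continuous g} ->
  (forall t, a < t < b -> is_derive t 1 f (df t)) ->
  (forall t, a < t < b -> is_derive t 1 g (dg t)) ->
  (forall t, a < t < b -> `|df t| <= dg t) ->
  `|f b - f a| <= g b - g a.
Proof.
move=> ab cf cg Df Dg fg.
have main (h dh : R -> R) : {within `[a, b], continuous h} ->
    (forall t, a < t < b -> is_derive t 1 h (dh t)) ->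
    (forall t, a < t < b -> 0 <= dh t) -> h a <= h b.
  move=> ch Dh h0; move: ab; rewrite le_eqVlt => /predU1P[->//|ab'].
  have Dh' (t : R) : t \in `]a, b[ -> is_derive t 1 h (dh t).
    by rewrite in_itv/= => tab; exact: Dh.
  have [c] := MVT ab' Dh' ch; rewrite in_itv/= => cab E; rewrite -subr_ge0 E mulr_ge0 ?h0//; lra.
have h1 := main (fun t => g t - f t) (fun t => dg t - df t) (within_itvB cg cf).
have h2 := main (fun t => g t + f t) (fun t => dg t + df t) (within_itvD cg cf).
have {}h1 : g a - f a <= g b - f b.
  apply: h1 => t tab; first exact: (is_derive1B (Dg t tab) (Df t tab)).
  by have := fg t tab; rewrite ler_norml; lra.
have {}h2 : g a + f a <= g b + f b.
  apply: h2 => t tab; first exact: (is_derive1D (Dg t tab) (Df t tab)).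
  by have := fg t tab; rewrite ler_norml; lra.
by rewrite ler_norml; lra.
Qed.

Lemma is_derive_expR_shift (k a t : R) :
  is_derive t 1 (fun s => expR (k * (s - a))) (k * expR (k * (t - a))).
Proof.
apply: (@is_derive_affine_comp _ _ _ (fun s => k * (s - a)) _ _ (- (k * a)) (@is_derive_expR R)) => s.
by ring.
Qed.

Lemma is_derive_powS n (y : R) : is_derive y 1 (fun z => z ^+ n.+1) (n.+1%:R * y ^+ n).
Proof.
elim: n => [|n IH].
  apply: (is_derive_eq (is_derive_id y 1)).
  by rewrite expr0 mulr1.
rewrite (_ : (fun z => _) = fun z => z * z ^+ n.+1); last first.
  by apply/funext => z; rewrite exprS.
apply: (is_derive_eq (is_derive1M (is_derive_id y 1) IH)).
by rewrite !exprS -[in RHS]natr1 -[in LHS]natr1; ring.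
Qed.

(** These are the successive integrals of a constant error in the Picard iteration. *)
Lemma is_derive_pow_fact (k a t : R) n :
  is_derive t 1 (fun s => (k * (s - a)) ^+ n.+1 / n.+1`!%:R) (k * ((k * (t - a)) ^+ n / n`!%:R)).
Proof.
have h (y : R) : is_derive y 1 (fun z => z ^+ n.+1 / n.+1`!%:R) (y ^+ n / n`!%:R).
  have -> : (fun z : R => z ^+ n.+1 / n.+1`!%:R) = fun z => n.+1`!%:R^-1 * z ^+ n.+1.
    by apply/funext => z; rewrite mulrC.
  apply: (is_derive_eq (is_derive1Z _ (is_derive_powS n y))).
  rewrite factS natrM invfM.
  by field; rewrite nat1r !pnatr_eq0 -lt0n fact_gt0.
apply: (@is_derive_affine_comp _ _ _ (fun s => k * (s - a)) _ _ (- (k * a)) h) => s.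
by ring.
Qed.

End comparison.

(** * Integrals of periodic functions over a full period *)

Section periodic_windows.
Context {R : realType}.
Notation mu := (@lebesgue_measure R).
Notation I01 := (`[0%R, 1%R]%classic : set R).
Context (psi : R -> R) (cpsi : continuous psi) (per : forall x, psi (x + 2) = psi x).

Let P A (r : R) := \int[mu]_(x in `[A, r]) psi x.

Let dP (A r : R) : A < r -> is_derive r 1 (P A) (psi r).
Proof.
move=> Ar; apply: (@is_derive_primitive _ (A - 1) (r + 1) psi r) => //; lra.
Qed.

Let cw (f : R -> R) (a b : R) : continuous f -> {within `[a, b], continuous f}.
Proof. by move=> cf; exact: continuous_subspaceT. Qed.

Let affine_integral (A a b k c : R) : a <= b -> k != 0 ->
  (forall s, a <= s <= b -> A < k * s + c) ->
  \int[mu]_(s in `[a, b]) psi (k * s + c) = (P A (k * b + c) - P A (k * a + c)) / k.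
Proof.
move=> ab k0 hA.
have D (s : R) : a <= s <= b -> is_derive s 1 (fun s => k^-1 * P A (k * s + c)) (psi (k * s + c)).
  move=> sab; have := is_derive1Z k^-1 (is_derive1_affine (dP (hA s sab))).
  by move=> /is_derive_eq; apply; rewrite mulrA mulVf// mul1r.
transitivity (k^-1 * P A (k * b + c) - k^-1 * P A (k * a + c)); last by ring.
apply: (@Rintegral_FTC2 _ (fun s => psi (k * s + c)) (fun s => k^-1 * P A (k * s + c))) => //.
- apply: cw => s; apply: (@continuous_comp _ _ _ (fun s => k * s + c) psi); last exact: cpsi.
  by apply: cvgD; [apply: cvgM; [exact: cvg_cst|exact: cvg_id]|exact: cvg_cst].
- apply: continuous_in_subspaceT => s; rewrite inE/= in_itv/= => sab.
  exact: is_derive1_continuous (D s sab).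
- by move=> s; rewrite in_itv/= => /andP[? ?]; apply: D; lra.
Qed.

Let P_window (A r s : R) : A < r -> r <= s -> P A (r + 2) - P A r = P A (s + 2) - P A s.
Proof.
move=> Ar rs.
have D (t : R) : r <= t -> is_derive t 1 (fun t => P A (1 * t + 2) - P A t) 0.
  move=> rt; have h1 : is_derive (1 * t + 2) 1 (P A) (psi (1 * t + 2)) by apply: dP; lra.
  have h2 : is_derive t 1 (P A) (psi t) by apply: dP; lra.
  apply: (is_derive_eq (is_derive1B (is_derive1_affine h1) h2)).
  by rewrite !mul1r per subrr.
have [||c _] := @MVT_segment _ (fun t => P A (1 * t + 2) - P A t) (fun=> 0) r s rs.
- by move=> t; rewrite in_itv/= => /andP[? ?]; apply: D; lra.
- apply: continuous_in_subspaceT => t; rewrite inE/= in_itv/= => /andP[rt _].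
  exact: is_derive1_continuous (D t rt).
- by rewrite mul0r !mul1r; lra.
Qed.

Let window_eq (A r s : R) : A < r -> A < s -> P A (r + 2) - P A r = P A (s + 2) - P A s.
Proof.
by move=> Ar As; have [rs|/ltW sr] := leP r s; [exact: P_window|apply/esym; exact: P_window].
Qed.

(** Substituting [r = 2 s + c] maps an interval of length one onto a full period, whose position is
    immaterial. *)
Lemma periodic_mean_const (a c c' : R) :
  \int[mu]_(s in `[a, a + 1]) psi (2 * s + c) = \int[mu]_(s in `[a, a + 1]) psi (2 * s + c').
Proof.
(* [A] lies strictly below every point at which the primitive [P A] is evaluated, so [P A] is
   differentiable there. *)
pose A := Num.min (2 * a + c) (2 * a + c') - 1.
have [A1 A2] : A < 2 * a + c /\ A < 2 * a + c'.
  by rewrite /A !ltrBlDr; split; rewrite gt_min; apply/orP; [left|right]; lra.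
rewrite !(@affine_integral A)//; [|lra|by move=> s /andP[? ?]; lra|lra|by move=> s /andP[? ?]; lra].
rewrite (_ : 2 * (a + 1) + c = 2 * a + c + 2); last by ring.
rewrite (_ : 2 * (a + 1) + c' = 2 * a + c' + 2); last by ring.
by rewrite (window_eq A1 A2).
Qed.

(** The two terms together integrate [psi] over the window [[-1 - z, 1 - z]], a full period. At
    [z = 0] evenness makes this twice the integral over [I]. *)
Lemma periodic_window_const (z : R) (ev : forall x, psi (- x) = psi x) :
  \int[mu]_(x in I01) (psi (x - z) + psi (- x - z)) = 2 * \int[mu]_(x in I01) psi x.
Proof.
have icomp (k c : R) : mu.-integrable I01 (EFin \o (fun x => psi (k * x + c))).
  apply: within_itv_integrable; apply: cw => s.
  apply: (@continuous_comp _ _ _ (fun s => k * s + c) psi); last exact: cpsi.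
  by apply: cvgD; [apply: cvgM; [exact: cvg_cst|exact: cvg_id]|exact: cvg_cst].
have main z' : \int[mu]_(x in I01) (psi (x - z') + psi (- x - z')) =
    \int[mu]_(x in I01) (psi (1 * x + - z')) + \int[mu]_(x in I01) (psi (-1 * x + - z')).
  by rewrite -RintegralD//; apply: eq_Rintegral => x _; rewrite mul1r mulN1r.
have -> : 2 * \int[mu]_(x in I01) psi x = \int[mu]_(x in I01) (psi (x - 0) + psi (- x - 0)).
  rewrite main mulr2n mulrDl !mul1r; congr (_ + _); apply: eq_Rintegral => x _.
    by rewrite mul1r oppr0 addr0.
  by rewrite oppr0 addr0 mulN1r ev.
rewrite !main.
pose A := - `|z| - 2.
have Az : A < -1 - z by rewrite /A; have := ler_norm z; lra.
have A0 : A < -1 - 0 by rewrite /A; have := normr_ge0 z; lra.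
have zA := ler_norm (- z); rewrite normrN in zA.
have N1 : (-1 : R) != 0 by rewrite oppr_eq0 oner_eq0.
have AE (k c : R) : k != 0 -> A < -1 + c -> A < 1 + c -> `|k| = 1 ->
    \int[mu]_(x in I01) psi (k * x + c) = (P A (k * 1 + c) - P A (k * 0 + c)) / k.
  move=> k0 Ac Ac' k1; apply: affine_integral => // s /andP[s0 s1].
  have : -1 <= k * s by have : `|k * s| <= 1 by [rewrite normrM k1 mul1r ger0_norm];
    rewrite ler_norml; lra.
  lra.
rewrite !AE ?normr1 ?normrN1 ?oner_neq0//; [|lra..].
have := window_eq Az A0.
rewrite (_ : -1 - z + 2 = 1 * 1 + - z); last by ring.
rewrite (_ : -1 - 0 + 2 = 1 * 1 + - 0); last by ring.
rewrite (_ : 1 * 0 + - z = -1 * 0 + - z); last by ring.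
rewrite (_ : 1 * 0 + - 0 = -1 * 0 + - 0); last by ring.
rewrite (_ : -1 - z = -1 * 1 + - z); last by ring.
rewrite (_ : -1 - 0 = -1 * 1 + - 0); last by ring.
by lra.
Qed.

End periodic_windows.

(** * Spatial integrals depending on a parameter *)

Section fixed_time.
Context {R : realType}.
Notation mu := (@lebesgue_measure R).
Notation I01 := (`[0%R, 1%R]%classic : set R).
Implicit Types (f : R -> R) (c : R -> R -> R).

Lemma pairing_parameter_continuous f c : LinftyI f -> continuous2 c ->
  continuous (fun s => \int[mu]_(x in I01) (f x * c x s)).
Proof.
move=> fL cc s; apply/cvgrPdist_le => e e0.
pose N := \int[mu]_(x in I01) `|f x|.
have N0 : 0 <= N by apply: Rintegral_ge0.
have e1 : 0 < e / (N + 1) by rewrite divr_gt0//; lra.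
have i1 r : mu.-integrable I01 (EFin \o (fun x => f x * c x r)).
  by apply: (@Linfty_pairing_integrable _ f (c^~ r)) => //; exact: continuous_sectionx.
near=> r.
have h : forall x, I01 x -> `|c x r - c x s| <= e / (N + 1).
  by near: r; exact: near_uniform_I.
rewrite distrC -RintegralB//; [|exact: i1..].
apply: (@le_trans _ _ (N * (e / (N + 1)))).
  under eq_Rintegral do rewrite -mulrBr.
  apply: pairing_le_L1 => //; first exact: Linfty_integrable.
  apply: (@Linfty_pairing_integrable _ f (fun x => c x r - c x s)) => //.
  by move=> x; apply: cvgB; apply: continuous_sectionx.
rewrite mulrCA ler_piMr ?(ltW e0)// ler_pdivrMr; lra.
Unshelve. all: by end_near. Qed.

(** Serves to average a smoothed solution over its centre by averaging the kernel instead. *)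
Lemma Fubini_pairing f c a b C : LinftyI f ->
  measurable_fun setT (fun p : R * R => c p.2 p.1) -> (forall x s, `|c x s| <= C) ->
  (forall x, continuous (c x)) ->
  \int[mu]_(s in `[a, b]) \int[mu]_(x in I01) (f x * c x s) =
  \int[mu]_(x in I01) (f x * \int[mu]_(s in `[a, b]) c x s).
Proof.
move=> fL mc cC cc.
have [M M0 fM] := LinftyI_ae_bounded fL.
pose A : set R := `[a, b]%classic; have mA : measurable A by exact: measurable_itv.
pose fI := f \_ I01.
have mfI : measurable_fun setT fI by apply/(measurable_restrictT f mI01); case: fM.
have C0 : 0 <= C := le_trans (normr_ge0 _) (cC 0 0).
have ifI : mu.-integrable setT (EFin \o fI).
  by rewrite -restrict_EFin; apply: (integrable_mkcond _ _).1; [exact: mI01|exact: Linfty_integrable].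
(* Extension by zero in both variables reduces the claim to integrals over the whole plane; the
   first coordinate is the parameter [s]. *)
pose F (p : R * R) : \bar R := (\1_A p.1 * (fI p.2 * c p.2 p.1))%:E.
have mF : measurable_fun setT F.
  apply/measurable_EFinP; apply: measurable_funM.
    exact: (measurableT_comp (measurable_indic mA) measurable_fst).
  by apply: measurable_funM => //; exact: (measurableT_comp mfI measurable_snd).
have iF : (mu \x mu)%E.-integrable setT F.
  apply/(integrable12ltyP mu mu mF).
  pose N := (\int[mu]_x `|fI x|%:E)%E.
  have nfI : measurable_fun setT (fun x => `|fI x|%:E).
    by apply/measurable_EFinP; exact: measurableT_comp.
  have E s : ((\1_A s)%:E * (C%:E * N))%E = (\int[mu]_x ((\1_A s * C)%:E * `|fI x|%:E))%E.
    by rewrite ge0_integralZl_EFin ?mulr_ge0// EFinM muleA.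
  have Nfin : (N < +oo)%E by have /integrableP[] := ifI.
  apply: (@le_lt_trans _ _ (\int[mu]_s ((\1_A s)%:E * (C%:E * N)))%E).
    apply: ge0_le_integral => //.
    - by move=> s _; exact: integral_ge0.
    - have mnF : measurable_fun setT (abse \o F) by exact: measurableT_comp.
      exact: (measurable_fun_fubini_tonelli_F (m2 := mu) _ mnF (fun=> abse_ge0 _)).
    - apply: emeasurable_funM => //.
      by apply/measurable_EFinP; exact: measurable_indic.
    - move=> s _; rewrite E; apply: ge0_le_integral => //.
      + apply: measurableT_comp => //.
        by apply: (measurableT_comp mF); exact: measurable_pair1.
      + exact: measurable_funeM.
      + move=> x _; rewrite /F/= -!EFinM lee_fin !normrM ger0_norm// -mulrA.
        by rewrite ler_wpM2l// mulrC ler_wpM2r.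
  rewrite ge0_integralZr//; last 2 first.
    by apply/measurable_EFinP; exact: measurable_indic.
    by rewrite mule_ge0// ?lee_fin// integral_ge0.
  rewrite integral_indic// setIT.
  rewrite lte_mul_pinfty//.
    rewrite ge0_fin_numE//.
    by rewrite /= lebesgue_measure_itv/=; case: ifP => _; rewrite ?ltry.
  rewrite lte_mul_pinfty// ?lee_fin//.
have FE := Fubini iF.
have icx x : mu.-integrable A (EFin \o c x).
  by apply: within_itv_integrable; exact: continuous_subspaceT.
have L : (\int[mu]_s \int[mu]_x F (s, x) =
    \int[mu]_(s in A) (\int[mu]_(x in I01) (f x * c x s))%:E)%E.
  rewrite [RHS]integral_mkcond; apply: eq_integral => s _.
  rewrite patchE; case: ifPn => sA; last first.
    by apply: integral0_eq => x _; rewrite /F/= indicE (negbTE sA) mul0r.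
  rewrite /Rintegral fineK; last first.
    apply: integrable_fin_num; first exact: mI01.
    apply: (@ae_bounded_integrableM _ M f C (c^~ s) fM) => //.
    apply: measurable_funTS.
    exact: (measurableT_comp mc (measurable_pair1 s)).
  rewrite [RHS]integral_mkcond; apply: eq_integral => x _.
  rewrite /F/= indicE sA mul1r /fI !patchE.
  by case: ifPn => // _; rewrite mul0r.
have Rr : (\int[mu]_x \int[mu]_s F (s, x) =
    \int[mu]_(x in I01) (f x * \int[mu]_(s in A) c x s)%:E)%E.
  rewrite [RHS]integral_mkcond; apply: eq_integral => x _.
  rewrite patchE; case: ifPn => xI; last first.
    by apply: integral0_eq => s _; rewrite /F/= /fI patchE (negbTE xI) mul0r mulr0.
  rewrite -RintegralZl//; rewrite /Rintegral fineK; last first.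
    apply: integrable_fin_num => //.
    have h : mu.-integrable A (fun s => ((f x)%:E * (EFin \o c x) s)%E) by exact: integrableZl.
    exact: h.
  rewrite [RHS]integral_mkcond; apply: eq_integral => s _.
  rewrite /F/= /fI !patchE xI indicE.
  by case: (s \in A); rewrite ?mul1r ?mul0r.
by rewrite /Rintegral -[X in fine X = _]L -[X in _ = fine X]Rr FE.
Qed.

End fixed_time.

(** * Decay of the smoothed solution *)

Section decay.
Context {R : realType}.
Notation mu := (@lebesgue_measure R).
Notation I01 := (`[0%R, 1%R]%classic : set R).
Context (psi dpsi : R -> R) (C : R) (hpsi : is_kernel psi dpsi C).
Context (d k a b : R) (alpha rho0 J0 : R -> R) (rho J : R -> R -> R).
Context (sol : weak_solution d alpha rho0 J0 rho J) (a0 : 0 <= a) (ab : a <= b)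
  (alphaE : forall t, a < t < b -> alpha t = k) (dk0 : 0 <= d * k).

Local Notation u := (smoothed rho J psi).

Let cst_cont (z : R) : continuous (fun _ : R => z). Proof. by move=> s; exact: cvg_cst. Qed.

Let parts_le (z x : R) : `|even_part psi z x| <= C /\ `|odd_part psi z x| <= C.
Proof.
case: hpsi => _ _ bp _ _; have [h1 _] := bp (x - z); have [h2 _] := bp (- x - z).
move: h1 h2; rewrite /even_part /odd_part !ler_norml => /andP[? ?] /andP[? ?].
by split; apply/andP; split; lra.
Qed.

(** A crude bound, dependent on the steepness of the kernel, whose only task is to start the
    iteration in [smoothed_sup_le]. *)
Lemma smoothed_bounded : exists2 B, 0 <= B & forall t z, a <= t <= b -> `|u z t| <= B.
Proof.
have C0 := kernel_ge0 hpsi; have cr := sol_rho sol; have cJ := sol_J sol.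
have [N1 N10 hN1] := L1_norm_bounded b cr a0.
have [N2 N20 hN2] := L1_norm_bounded b cJ a0.
exists (N1 * C + N2 * C); first by rewrite addr_ge0// mulr_ge0.
move=> t z tab; have t0 : 0 <= t by case/andP: tab => h _; exact: le_trans h.
have ce := continuous2_even_part hpsi (@cst_cont z).
have co := continuous2_odd_part hpsi (@cst_cont z).
rewrite /smoothed (le_trans (ler_normD _ _))// lerD//.
- apply: (@le_trans _ _ (\int[mu]_(x in I01) `|rho x t| * C)); last by rewrite ler_wpM2r// hN1.
  apply: pairing_le_L1.
  + by case: cr => + _; move=> /(_ t t0); exact: Linfty_integrable.
  + exact: (pairing_integrable cr ce t0).
  + by move=> x _; case: (parts_le z x).
- apply: (@le_trans _ _ (\int[mu]_(x in I01) `|J x t| * C)); last by rewrite ler_wpM2r// hN2.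
  apply: pairing_le_L1.
  + by case: cJ => + _; move=> /(_ t t0); exact: Linfty_integrable.
  + exact: (pairing_integrable cJ co t0).
  + by move=> x _; case: (parts_le z x).
Qed.

(** The integrating factor: [1 / E t] is the weight of the paths that have not been reflected since
    time [a]. *)
Let E t := expR (d * k * (t - a)).

Let E_a : E a = 1. Proof. by rewrite /E subrr mulr0 expR0. Qed.

Let dE (t : R) : is_derive t 1 E (d * k * E t). Proof. exact: is_derive_expR_shift. Qed.

Let E_cont s1 s2 : {within `[s1, s2], continuous E}.
Proof. by apply: continuous_subspaceT => t; exact: is_derive1_continuous (dE t). Qed.

Let w y t := E t * u (y + t) t.

Let w_cont y t : {within `[a, t], continuous (w y)}.
Proof.
apply: within_itvM; first exact: E_cont.
apply: (smoothed_within_continuous hpsi sol) => //.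
by move=> s; apply: cvgD; [exact: cvg_cst|exact: cvg_id].
Qed.

Let dw (y t : R) : a < t < b -> is_derive t 1 (w y) (d * k * (E t * u (- (y + t)) t)).
Proof.
move=> tab; have := is_derive_smoothed_characteristic hpsi sol a0 alphaE y tab.
move=> h; apply: (is_derive_eq (is_derive1M (dE t) h)).
by ring.
Qed.

(** Inserting a bound of [E t * u z t] for all [z] into the equation along characteristics and
    integrating reproduces the part [M * E t] and improves the error by one more factor of the
    exponential series. *)
Lemma smoothed_sup_le M : (forall z, `|u z a| <= M) ->
  forall t z, a <= t <= b -> `|u z t| <= M.
Proof.
move=> hM; have M0 : 0 <= M := le_trans (normr_ge0 _) (hM 0).
have [B B0 hB] := smoothed_bounded.
have E1 t : a <= t -> 1 <= E t.
  by move=> at_; rewrite /E -expR0 ler_expR mulr_ge0// subr_ge0.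
(* The crude bound of [E t * u z t] on [[a, b]], which settles [n = 0]. *)
pose B' := E b * B.
have claim n : forall t z, a <= t <= b ->
    `|E t * u z t| <= M * E t + B' * ((d * k * (t - a)) ^+ n / n`!%:R).
  elim: n => [|n IH] t z /andP[at_ tb].
    rewrite expr0 fact0 invr1 !mulr1 normrM ger0_norm ?expR_ge0//.
    rewrite (@le_trans _ _ B')// ?lerDr ?mulr_ge0 ?expR_ge0//.
    by rewrite ler_pM ?expR_ge0 ?hB ?at_// ler_expR ler_wpM2l// lerB.
  pose g s := M * E s + B' * ((d * k * (s - a)) ^+ n.+1 / n.+1`!%:R).
  pose dg s := M * (d * k * E s) + B' * (d * k * ((d * k * (s - a)) ^+ n / n`!%:R)).
  have Dg (s : R) : is_derive s 1 g (dg s).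
    exact: (is_derive1D (is_derive1Z M (dE s)) (is_derive1Z B' (is_derive_pow_fact _ _ _ _))).
  have cg : {within `[a, t], continuous g}.
    by apply: continuous_subspaceT => s; exact: is_derive1_continuous (Dg s).
  have Dw (s : R) : a < s < t ->
      is_derive s 1 (w (z - t)) (d * k * (E s * u (- ((z - t) + s)) s)).
    by move=> /andP[as_ st]; apply: dw; rewrite as_ (lt_le_trans st).
  have H : `|w (z - t) t - w (z - t) a| <= g t - g a.
    apply: (derive_dominated_le at_ (@w_cont _ _) cg Dw (fun s _ => Dg s)).
    move=> s /andP[as_ st]; rewrite normrM ger0_norm//.
    have -> : dg s = d * k * (M * E s + B' * ((d * k * (s - a)) ^+ n / n`!%:R)).
      by rewrite /dg; ring.
    by rewrite ler_wpM2l// IH// (ltW as_) (ltW (lt_le_trans st tb)).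
  have wt : w (z - t) t = E t * u z t by rewrite /w subrK.
  have wa : `|w (z - t) a| <= M by rewrite /w E_a mul1r hM.
  have ga : g a = M by rewrite /g E_a subrr mulr0 expr0n/= mul0r mulr0 addr0 mulr1.
  rewrite -wt -/(g t); move: H wa; rewrite ga.
  rewrite !ler_norml => /andP[? ?] /andP[? ?]; apply/andP; split; lra.
move=> t z tab; have at_ : a <= t by case/andP: tab.
have Et := E1 t at_.
suff : `|E t * u z t| <= M * E t.
  by rewrite normrM ger0_norm ?expR_ge0// mulrC ler_pM2r ?expR_gt0.
apply/ler_addgt0Pr => e e0.
have e1 : 0 < e / (B' + 1) by rewrite divr_gt0// ltr_wpDl// mulr_ge0 ?expR_ge0.
(* The errors are, up to [B'], the terms of a convergent exponential series, so one of them is small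
   enough. *)
have /cvgrPdist_le/(_ _ e1)[n _ /(_ n (leqnn n))] := cvg_exp_coeff (d * k * (t - a)).
rewrite sub0r normrN exp_coeffE/= => hn.
apply: (le_trans (claim n t z tab)); rewrite lerD2l.
have : (d * k * (t - a)) ^+ n / n`!%:R <= e / (B' + 1).
  by apply: le_trans hn; rewrite mulrC; exact: ler_norm.
have B'0 : 0 <= B' by rewrite mulr_ge0 ?expR_ge0.
move=> /(ler_wpM2l B'0) /le_trans; apply.
rewrite mulrCA ler_piMr ?(ltW e0)// ler_pdivrMr; lra.
Qed.


(** The subtracted value is the contribution of no reflection. The paths reflected at least once
    have relative weight [E t - 1]. *)
Let refined M t z : (forall z, `|u z a| <= M) -> a <= t <= b ->
  `|E t * u z t - u (z - t + a) a| <= M * E t - M.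
Proof.
move=> hM /andP[at_ tb].
have DE (s : R) : is_derive s 1 (fun s => M * E s) (M * (d * k * E s)).
  exact: is_derive1Z.
have cg : {within `[a, t], continuous (fun s => M * E s)}.
  by apply: continuous_subspaceT => s; exact: is_derive1_continuous (DE s).
have Dw (s : R) : a < s < t ->
    is_derive s 1 (w (z - t)) (d * k * (E s * u (- ((z - t) + s)) s)).
  by move=> /andP[as_ st]; apply: dw; rewrite as_ (lt_le_trans st).
have := derive_dominated_le at_ (@w_cont _ _) cg Dw (fun s _ => DE s).
rewrite E_a mulr1 /w E_a mul1r subrK; apply => s /andP[as_ st].
rewrite normrM ger0_norm// mulrCA ler_wpM2l// normrM ger0_norm ?expR_ge0//.
by rewrite mulrC ler_wpM2r ?expR_ge0// smoothed_sup_le// (ltW as_) (ltW (lt_le_trans st tb)).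
Qed.

Let integrable_double (c : R) :
  mu.-integrable `[a, a + 1] (EFin \o (fun s => psi (2 * s + c))).
Proof.
have cp : continuous (fun s : R => psi (2 * s + c)).
  move=> s; apply: (@continuous_comp _ _ _ (fun s : R => 2 * s + c) psi).
    by apply: cvgD; [apply: cvgM; [exact: cvg_cst|exact: cvg_id]|exact: cvg_cst].
  exact: (kernel_continuous hpsi).
by apply: within_itv_integrable; exact: continuous_subspaceT.
Qed.

(** As [s] crosses an interval of length one the centre crosses a full period, so the average no
    longer depends on [x]: paired with [rho], it sees only the integral of [rho]. *)
Let even_part_mean (y x : R) :
  \int[mu]_(s in `[a, a + 1]) even_part psi (y - 2 * s) x =
  \int[mu]_(s in `[a, a + 1]) psi (2 * s + 0).
Proof.
case: (hpsi) => _ _ _ _ per; have cp := kernel_continuous hpsi.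
have ip := integrable_double.
transitivity (\int[mu]_(s in `[a, a + 1])
    (2^-1 * (psi (2 * s + (x - y)) + psi (2 * s + (- x - y))))).
  apply: eq_Rintegral => s _; rewrite /even_part mulrC.
  by congr (_ * (psi _ + psi _)); ring.
rewrite RintegralZl//; last first.
  rewrite (_ : _ \o _ = (EFin \o (fun s => psi (2 * s + (x - y)))) \+
    (EFin \o (fun s => psi (2 * s + (- x - y)))))%E; last exact/funext.
  by apply: integrableD => //; exact: ip.
rewrite RintegralD//; [|exact: ip..].
rewrite (periodic_mean_const cp per a (x - y) 0) (periodic_mean_const cp per a (- x - y) 0).
by field.
Qed.

Let odd_part_mean (y x : R) :
  \int[mu]_(s in `[a, a + 1]) odd_part psi (y - 2 * s) x = 0.
Proof.
case: (hpsi) => _ _ _ _ per; have cp := kernel_continuous hpsi.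
have ip := integrable_double.
transitivity (\int[mu]_(s in `[a, a + 1])
    (2^-1 * (psi (2 * s + (x - y)) - psi (2 * s + (- x - y))))).
  apply: eq_Rintegral => s _; rewrite /odd_part mulrC.
  by congr (_ * (psi _ - psi _)); ring.
rewrite RintegralZl//; last first.
  rewrite (_ : _ \o _ = (EFin \o (fun s => psi (2 * s + (x - y)))) \-
    (EFin \o (fun s => psi (2 * s + (- x - y)))))%E; last exact/funext.
  by apply: integrableB => //; exact: ip.
rewrite RintegralB//; [|exact: ip..].
by rewrite (periodic_mean_const cp per a (x - y) (- x - y)) subrr mulr0.
Qed.

Let slide_cont (y : R) : continuous (fun s : R => y - 2 * s).
Proof.
by move=> s; apply: cvgB; [exact: cvg_cst|apply: cvgM; [exact: cvg_cst|exact: cvg_id]].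
Qed.

Let measurable_slide (y sg : R) :
  measurable_fun setT (fun p : R * R => psi (sg * p.2 - (y - 2 * p.1))).
Proof.
apply: measurableT_comp; first exact: continuous_measurable_fun (kernel_continuous hpsi).
apply: measurable_funB; first exact: measurable_funM.
by apply: measurable_funB => //; exact: measurable_funM.
Qed.

(* A single reflection contributes the mean of [G] over the whole circle. *)
Lemma smoothed_mean_eq0 (y : R) : \int[mu]_(x in I01) rho x a = 0 ->
  \int[mu]_(s in `[a, a + 1]) u (y - 2 * s) a = 0.
Proof.
move=> r0; have cr := sol_rho sol; have cJ := sol_J sol.
have rL : LinftyI (rho^~ a) by case: cr => + _; apply.
have JL : LinftyI (J^~ a) by case: cJ => + _; apply.
have ce := continuous2_even_part hpsi (@slide_cont y).
have co := continuous2_odd_part hpsi (@slide_cont y).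
have pe := pairing_parameter_continuous rL ce.
have po := pairing_parameter_continuous JL co.
have me : measurable_fun setT (fun p : R * R => even_part psi (y - 2 * p.1) p.2).
  apply: measurable_funM => //; apply: measurable_funD.
    have := measurable_slide y 1; apply: eq_measurable_fun => p _; by rewrite mul1r.
  have := measurable_slide y (-1); apply: eq_measurable_fun => p _; by rewrite mulN1r.
have mo : measurable_fun setT (fun p : R * R => odd_part psi (y - 2 * p.1) p.2).
  apply: measurable_funM => //; apply: measurable_funB.
    have := measurable_slide y 1; apply: eq_measurable_fun => p _; by rewrite mul1r.
  have := measurable_slide y (-1); apply: eq_measurable_fun => p _; by rewrite mulN1r.
have sectiont (c : R -> R -> R) x : continuous2 c -> continuous (c x).
  move=> cc s; apply: (@continuous_comp _ _ _ (fun s => (x, s)) (fun p : R * R => c p.1 p.2)).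
    by apply: (@cvg_pair _ _ _ _ (nbhs x) (nbhs s)); [exact: cvg_cst|exact: cvg_id].
  exact: cc.
rewrite /smoothed RintegralD//; last 2 first.
- by apply: within_itv_integrable; exact: continuous_subspaceT pe.
- by apply: within_itv_integrable; exact: continuous_subspaceT po.
rewrite (Fubini_pairing a (a + 1) rL me (fun x s => (parts_le _ x).1) (fun x => sectiont _ x ce)).
rewrite (Fubini_pairing a (a + 1) JL mo (fun x s => (parts_le _ x).2) (fun x => sectiont _ x co)).
under eq_Rintegral do rewrite even_part_mean.
under [X in _ + X]eq_Rintegral do rewrite odd_part_mean mulr0.
rewrite RintegralZr//; last exact: Linfty_integrable.
by rewrite r0 mul0r add0r Rintegral_cst ?mul0r//; exact: mI01.
Qed.

(** Using [refined] under the integral along a characteristic separates the single reflections,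
    whose total vanishes. Multiple reflections have relative weight [expR (d * k) - 1 - d * k];
    adding [1] for no reflection gives [expR (d * k) - d * k]. *)
Lemma smoothed_contraction M : b = a + 1 -> \int[mu]_(x in I01) rho x a = 0 ->
  (forall z, `|u z a| <= M) ->
  forall z, `|u z b| <= expR (- (d * k)) * (expR (d * k) - d * k) * M.
Proof.
(* [y] labels the characteristic that reaches [z] at time [b]. *)
move=> bE r0 hM z; pose y := z - b.
have rL : LinftyI (rho^~ a) by case: (sol_rho sol) => + _; apply.
have JL : LinftyI (J^~ a) by case: (sol_J sol) => + _; apply.
(* A path that joins this characteristic by a single reflection at time [s] comes from [- (y + s)]
   at that time, hence from [a - y - 2 s] at time [a]. *)
pose g s := u ((a - y) - 2 * s) a.
have cg : continuous g.
  move=> s; apply: cvgD.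
    exact: (pairing_parameter_continuous rL (continuous2_even_part hpsi (@slide_cont (a - y)))).
  exact: (pairing_parameter_continuous JL (continuous2_odd_part hpsi (@slide_cont (a - y)))).
(* Starting at [a - 1] makes [G] differentiable on the whole of [[a, b]]. *)
pose G t := \int[mu]_(s in `[a - 1, t]) g s.
have dG (t : R) : a <= t -> t <= b -> is_derive t 1 G (g t).
  move=> at_ tb; apply: (@is_derive_primitive _ (a - 2) (b + 1) g t) => //; try lra.
have G0 : G b - G a = 0.
  transitivity (\int[mu]_(s in `[a, a + 1]) g s); last exact: smoothed_mean_eq0.
  rewrite -bE; apply/esym; apply: Rintegral_FTC2 => //.
  - exact: continuous_subspaceT.
  - apply: continuous_in_subspaceT => t; rewrite inE/= in_itv/= => /andP[at_ tb].
    exact: is_derive1_continuous (dG t at_ tb).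
  - by move=> t; rewrite in_itv/= => /andP[/ltW at_ /ltW tb]; exact: dG.
pose X t := w y t - d * k * G t.
pose dX t := d * k * (E t * u (- (y + t)) t) - d * k * g t.
(* [beta] is a primitive of [d k (M E t - M)], the bound that [refined] gives for the multiple
   reflections. *)
pose beta t := M * (E t - d * k * t); pose dbeta t := M * (d * k * E t - d * k * 1).
have DX (t : R) : a < t < b -> is_derive t 1 X (dX t).
  move=> /[dup] tab /andP[/ltW at_ /ltW tb].
  exact: (is_derive1B (dw y tab) (is_derive1Z _ (dG t at_ tb))).
have Dbeta (t : R) : is_derive t 1 beta (dbeta t).
  exact: (is_derive1Z M (is_derive1B (dE t) (is_derive1Z _ (is_derive_id t 1)))).
have cX : {within `[a, b], continuous X}.
  apply: within_itvB; first exact: w_cont.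
  apply: within_itvM; first exact: continuous_subspaceT.
  apply: continuous_in_subspaceT => t; rewrite inE/= in_itv/= => /andP[at_ tb].
  exact: is_derive1_continuous (dG t at_ tb).
have cbeta : {within `[a, b], continuous beta}.
  by apply: continuous_subspaceT => t; exact: is_derive1_continuous (Dbeta t).
have H : `|X b - X a| <= beta b - beta a.
  apply: (derive_dominated_le ab cX cbeta DX (fun t _ => Dbeta t)) => t /andP[/ltW at_ /ltW tb].
  rewrite /dX -mulrBr normrM ger0_norm//.
  have -> : dbeta t = d * k * (M * E t - M) by rewrite /dbeta; ring.
  rewrite ler_wpM2l//.
  have := @refined M t (- (y + t)) hM; rewrite at_ tb => /(_ isT).
  by rewrite (_ : - (y + t) - t + a = a - y - 2 * t)//; ring.
have Eb : E b = expR (d * k) by rewrite /E bE addrAC subrr add0r mulr1.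
have XE : X b - X a = E b * u z b - u (y + a) a.
  transitivity (w y b - w y a - d * k * (G b - G a)); first by rewrite /X; ring.
  by rewrite G0 mulr0 subr0 /w E_a mul1r /y subrK.
have bE' : beta b - beta a = M * (E b - 1 - d * k).
  by rewrite /beta E_a bE; ring.
have {}H : E b * `|u z b| <= (expR (d * k) - d * k) * M.
  have := hM (y + a); move: H; rewrite XE bE' Eb.
  rewrite -[X in X * `|_|](ger0_norm (expR_ge0 (d * k))) -normrM.
  by rewrite !ler_norml => /andP[? ?] /andP[? ?]; apply/andP; split; lra.
rewrite -mulrA -ler_pdivrMl ?expR_gt0// expRN invrK.
by rewrite Eb in H.
Qed.

End decay.

(** * From smoothed solutions back to pointwise bounds *)

Section box_kernels.
Context {R : realType}.
Notation mu := (@lebesgue_measure R).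
Notation I01 := (`[0%R, 1%R]%classic : set R).
Implicit Types (h x y z : R) (n : nat).

Lemma cosDpi x : cos (x + pi) = - cos x.
Proof. by rewrite cosD cospi sinpi mulrN1 mulr0 subr0. Qed.

(* As [n] grows, these smooth kernels increase to the indicator of the
   [2]-periodic union of the intervals [(2 j - h, 2 j + h)]. *)
Definition box_kernel h n x : R := smoothstep (n.+1%:R * cos (pi * x) + - (n.+1%:R * cos (pi * h))).

Definition dbox_kernel h n x : R :=
  hat (n.+1%:R * cos (pi * x) + - (n.+1%:R * cos (pi * h))) * (n.+1%:R * (pi * - sin (pi * x))).

Lemma is_derive_box_kernel h n x : is_derive x 1 (box_kernel h n) (dbox_kernel h n x).
Proof.
have dcos : is_derive x 1 (fun x => cos (pi * x)) (pi * - sin (pi * x)).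
  apply: (@is_derive_affine_comp _ cos (fun x => - sin x) (fun x => pi * x) x pi 0
    (@is_derive_cos R)).
  by move=> y; rewrite addr0.
have d2 := is_derive1B (is_derive1Z n.+1%:R dcos) (is_derive_cst (n.+1%:R * cos (pi * h)) x 1).
rewrite subr0 in d2.
exact: (@is_derive1_comp _ smoothstep (fun x => n.+1%:R * cos (pi * x) - n.+1%:R * cos (pi * h))
  x _ _ (is_derive_smoothstep _) d2).
Qed.

Lemma continuous_piM (f : R -> R) : continuous f -> continuous (fun x => f (pi * x)).
Proof.
move=> cf x; apply: (@continuous_comp _ _ _ (fun x : R => pi * x) f); last exact: cf.
by apply: cvgM; [exact: cvg_cst|exact: cvg_id].
Qed.

(** The constant grows with [n], but it enters only dominated convergence and the crude initial
    bound, never the decay estimates. *)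
Lemma box_kernelP h n : is_kernel (box_kernel h n) (dbox_kernel h n) (1 + n.+1%:R * pi).
Proof.
have p0 : 0 < n.+1%:R * pi :> R by rewrite mulr_gt0// pi_gt0.
split.
- exact: is_derive_box_kernel.
- move=> x; apply: cvgM.
    apply: (@continuous_comp _ _ _
      (fun x => n.+1%:R * cos (pi * x) + - (n.+1%:R * cos (pi * h))) hat).
      apply: cvgD; last exact: cvg_cst.
      by apply: cvgM; [exact: cvg_cst|exact: (continuous_piM (@continuous_cos R))].
    exact: continuous_hat.
  apply: cvgM; first exact: cvg_cst.
  apply: cvgM; first exact: cvg_cst.
  apply: cvgN; exact: (continuous_piM (@continuous_sin R)).
- move=> x; split.
    have /andP[s0 s1] := smoothstep_itv (n.+1%:R * cos (pi * x) + - (n.+1%:R * cos (pi * h))).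
    by rewrite ger0_norm// (le_trans s1)// lerDl ltW.
  have /andP[s0 s1] := hat_itv (n.+1%:R * cos (pi * x) + - (n.+1%:R * cos (pi * h))).
  rewrite /dbox_kernel normrM ger0_norm// (@le_trans _ _ (1 * (n.+1%:R * pi)))//; last first.
    by rewrite mul1r lerDr.
  apply: ler_pM => //; rewrite mulrA normrM (gtr0_norm p0) normrN.
  by rewrite ler_piMr ?(ltW p0)// sin_max.
- by move=> x; rewrite /box_kernel mulrN cosN.
- move=> x; rewrite /box_kernel (_ : pi * (x + 2) = pi * x + pi + pi); last by ring.
  by rewrite !cosDpi opprK.
Qed.

(** Cosine decreases on [[0, pi]], so the argument of [smoothstep] is nonpositive there. *)
Lemma box_kernel_out h n x : 0 <= h -> h <= `|x| <= 1 -> box_kernel h n x = 0.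
Proof.
move=> h0 /andP[hx x1]; apply: smoothstep_le0; rewrite -mulrBr pmulr_rle0// subr_le0.
rewrite -(cos_norm (pi * x)) normrM (gtr0_norm (pi_gt0 _)).
have := hx; rewrite le_eqVlt => /predU1P[->//|hx'].
have p0 := pi_gt0 R.
have i (y : R) : 0 <= y <= 1 -> pi * y \in `[0, pi].
  by move=> /andP[y0 y1]; rewrite in_itv/= mulr_ge0 ?(ltW p0)// ler_piMr// ltW.
rewrite ltW// ltr_cos ?i ?normr_ge0//; last by rewrite h0 (le_trans hx).
by rewrite ltr_pM2l.
Qed.

Lemma box_kernel_in h x : `|x| < h -> h <= 1 -> \forall n \near \oo, box_kernel h n x = 1.
Proof.
move=> xh h1; have p0 := pi_gt0 R; have x0 := normr_ge0 x.
have i (y : R) : 0 <= y <= 1 -> pi * y \in `[0, pi].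
  by move=> /andP[y0 y1]; rewrite in_itv/= mulr_ge0 ?(ltW p0)// ler_piMr// ltW.
have c0 : 0 < cos (pi * x) - cos (pi * h).
  rewrite subr_gt0 -(cos_norm (pi * x)) normrM (gtr0_norm p0).
  rewrite ltr_cos ?i//; first by rewrite ltr_pM2l.
    by rewrite x0 ltW// (lt_le_trans xh).
  by rewrite (ltW (le_lt_trans x0 xh)).
near=> n; apply: smoothstep_ge2; rewrite -mulrBr -ler_pdivrMr//.
apply: (@le_trans _ _ n%:R); last by rewrite ler_nat.
near: n; exact: nbhs_infty_ger.
Unshelve. all: by end_near. Qed.

Lemma box_kernel_itv h n x : 0 <= box_kernel h n x <= 1.
Proof. exact: smoothstep_itv. Qed.

Lemma box_kernel_continuous h n : continuous (box_kernel h n).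
Proof. exact: kernel_continuous (box_kernelP h n). Qed.

Lemma indic_itv_integral h : 0 <= h <= 1 -> \int[mu]_(x in I01) \1_(`[0%R, h]%classic : set R) x = h.
Proof.
move=> /andP[h0 h1].
have mA : measurable (`[0%R, h]%classic : set R) by exact: measurable_itv.
rewrite /Rintegral integral_indic//.
rewrite setIidl; first by rewrite itv_lebesgueE ?subr0.
by move=> x /=; rewrite !in_itv/= => /andP[-> xh]; exact: le_trans h1.
Qed.

(** On [I] the kernel lies below the indicator of [[0, h]], uniformly in [n]. *)
Lemma box_kernel_mass h n : 0 < h <= 1 -> \int[mu]_(x in I01) box_kernel h n x <= h.
Proof.
move=> /andP[h0 h1]; rewrite -[leRHS]indic_itv_integral ?(ltW h0)//.
have mA : measurable (`[0%R, h]%classic : set R) by exact: measurable_itv.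
apply: le_Rintegral.
- exact: mI01.
- by apply: within_itv_integrable; exact/continuous_subspaceT/box_kernel_continuous.
- apply: (@measurable_bounded_integrable _ _ _ mu); first exact: mI01.
  + by rewrite /= lebesgue_measure_itv/= lte01 sube0 ltry.
  + by apply: measurable_funTS; exact: measurable_indic.
  + by exists 1; split => // r r1 x _ /=; rewrite (le_trans _ (ltW r1))// indicE; case: (_ \in _); rewrite ?normr1 ?normr0.
- move=> x; rewrite /= in_itv/= => /andP[x0 x1]; rewrite indicE.
  have [xh|xh] := leP x h.
    by rewrite mem_set ?(andP (box_kernel_itv h n x)).2//= in_itv/= x0.
  rewrite [leLHS]box_kernel_out ?ler0n ?(ltW h0)// ger0_norm// (ltW xh)//.
Qed.

End box_kernels.

(** * From averages over balls to pointwise bounds *)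

Section averages.
Context {R : realType}.
Notation mu := (@lebesgue_measure R).
Notation I01 := (`[0%R, 1%R]%classic : set R).
Implicit Types (f : R -> R) (K h x y z : R).

Lemma ball_pairing_integrable f y h : LinftyI f ->
  mu.-integrable I01 (EFin \o (fun x => f x * \1_(ball y h) x)).
Proof.
move=> fL; have [M _ fM] := LinftyI_ae_bounded fL.
apply: (ae_bounded_integrableM (C := 1) fM).
- by apply: measurable_funTS; apply: measurable_indic; exact: measurable_ball.
- by move=> x _; rewrite indicE; case: (x \in (ball y h : set R)); rewrite ?normr1 ?normr0.
Qed.

(** At an interior Lebesgue point small balls stay in [I], and the averages of [f] over them
    converge to its value. *)
Lemma ae_le_of_averages f K : LinftyI f ->
  (forall y h, 0 < h -> h <= y -> y + h <= 1 ->
    `|\int[mu]_(x in I01) (f x * \1_(ball y h) x)| <= K * (2 * h)) ->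
  {ae mu, forall x, I01 x -> `|f x| <= K}.
Proof.
move=> fL avg; pose fI := f \_ I01.
have ifI : mu.-integrable setT (EFin \o fI).
  by rewrite -restrict_EFin; apply: (integrable_mkcond _ _).1; [exact: mI01|exact: Linfty_integrable].
have locf : locally_integrable setT fI by exact: open_integrable_locally openT ifI.
pose r (n : nat) : {posnum R} := PosNum (@divr_gt0 R 1 n.+1%:R ltr01 (ltr0Sn _ n)).
have rE n : (r n)%:num = n.+1%:R^-1 by rewrite /= mul1r.
have nice x : nicely_shrinking x (fun n => ball x (r n)%:num).
  split; first by move=> n; exact: measurable_ball.
  exists (1, r); split => //=.
    by under eq_fun do rewrite mul1r; exact: cvg_harmonic.
    by move=> n; exact: subset_refl.
  by move=> n; rewrite mul1e.
have H := lebesgue_differentiation locf.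
have H' := @ae_interior R (fun x => 0 < x < 1) (fun x => id).
apply: filterS2 H H'; first exact: (ae_filter_ringOfSetsType mu).
move=> x lx /[swap] Ix /(_ Ix) x01.
have := @nice_lebesgue_differentiation _ (fun x n => ball x (r n)%:num) nice fI locf x lx.
have -> : fI x = f x by rewrite /fI patchE mem_set.
move=> cvgf.
have m0 : 0 < Num.min x (1 - x) by case/andP: x01 => ? ?; rewrite lt_min; lra.
have bound : \forall n \near \oo,
   ((- K)%:E <= (mu (ball x (r n)%:num))^-1 * \int[mu]_(y in ball x (r n)%:num) (fI y)%:E <= K%:E)%E.
  near=> n; set h := (r n)%:num; have h0 : 0 < h by rewrite /h rE invr_gt0.
  have : h < Num.min x (1 - x).
    by rewrite /h rE; near: n; exact: (near_infty_natSinv_lt (PosNum m0)).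
  rewrite lt_min => /andP[hx hx'].
  have -> : (\int[mu]_(y in ball x h) (fI y)%:E = (\int[mu]_(y in I01) (f y * \1_(ball x h) y))%:E)%E.
    rewrite /Rintegral fineK; last first.
      by apply: integrable_fin_num; [exact: mI01|exact: ball_pairing_integrable].
    rewrite [LHS]integral_mkcond [RHS]integral_mkcond; apply: eq_integral => y _.
    rewrite /fI !patchE indicE.
    by case: (y \in (ball x h : set R)); case: (y \in I01); rewrite ?mulr1 ?mulr0.
  rewrite lebesgue_measure_ball ?(ltW h0)//.
  rewrite inver mulrn_eq0/= gt_eqF// -EFinM !lee_fin -ler_norml normrM.
  have h2 : 0 < h *+ 2 by rewrite mulrn_wgt0.
  rewrite gtr0_norm ?invr_gt0// mulrC ler_pdivrMr// -mulr_natl.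
  by apply: avg => //; lra.
rewrite ler_norml -!lee_fin -(cvg_lim _ cvgf)//; apply/andP; split.
- apply: lime_ge; first by apply/cvg_ex; exists (f x)%:E.
  by apply: filterS bound => n /andP[].
- apply: lime_le; first by apply/cvg_ex; exists (f x)%:E.
  by apply: filterS bound => n /andP[].
Unshelve. all: by end_near. Qed.

Lemma box_kernel_cvg_ball f y h : LinftyI f -> 0 < h -> h <= y -> y + h <= 1 ->
  \int[mu]_(x in I01) (f x * box_kernel h n (x - y)) @[n --> \oo] -->
  \int[mu]_(x in I01) (f x * \1_(ball y h) x).
Proof.
move=> fL h0 hy yh; have mf : measurable_fun I01 f by have [M _ []] := LinftyI_ae_bounded fL.
apply: (@Rintegral_dominated_cvg _ _ _ _ (fun x => `|f x|)).
- exact: mI01.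
- move=> n; apply: measurable_funM => //; apply: measurable_funTS.
  apply: continuous_measurable_fun => x.
  apply: (@continuous_comp _ _ _ (fun x : R => x - y) (box_kernel h n)); last exact: box_kernel_continuous.
  by apply: cvgB; [exact: cvg_id|exact: cvg_cst].
- apply: measurable_funM => //; apply: measurable_funTS.
  by apply: measurable_indic; exact: measurable_ball.
- apply: aeW => x; rewrite /= in_itv/= => /andP[x0 x1].
  have xy1 : `|x - y| <= 1 by rewrite ler_norml; lra.
  apply: cvg_near_cst; rewrite indicE.
  have [xyh|xyh] := ltP `|x - y| h.
    rewrite mem_set; last by rewrite /ball/= distrC.
    have h1 : h <= 1 by lra.
    by apply: filterS (box_kernel_in xyh h1) => n ->.
  rewrite memNset; last by rewrite /ball/= distrC; apply/negP; rewrite -leNgt.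
  by apply: nearW => n; rewrite box_kernel_out ?(ltW h0)// xyh.
- exact/Rintegral_norm_integrable/Linfty_integrable.
- apply: aeW => x n _; rewrite normrM ler_piMr//.
  by have /andP[s0 s1] := box_kernel_itv h n (x - y); rewrite ger0_norm.
Qed.

(** The mirror image of a ball contained in [I] lies in [[-1, 0]], so on the circle its interior
    misses [I]. Hence a box around [y] sees only one of the two halves of [G]. *)
Lemma box_kernel_reflected h n x y : I01 x -> 0 < h -> h <= y -> y + h <= 1 ->
  box_kernel h n (- x - y) = 0.
Proof.
rewrite /= in_itv/= => /andP[x0 x1] h0 hy yh.
have [_ _ _ ev per] := box_kernelP h n.
have [xy|xy] := leP (x + y) 1.
  by rewrite box_kernel_out ?(ltW h0)// ler0_norm; lra.
by rewrite -per box_kernel_out ?(ltW h0)// ger0_norm; lra.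
Qed.

End averages.

(** * Conserved mean, initial bound and recovery of the norms *)

Section propagation.
Context {R : realType}.
Notation mu := (@lebesgue_measure R).
Notation I01 := (`[0%R, 1%R]%classic : set R).
Context (d : R) (alpha rho0 J0 : R -> R) (rho J : R -> R -> R).
Context (sol : weak_solution d alpha rho0 J0 rho J).

(** Smoothing with the constant kernel gives the integral of [rho], so conservation of the zero mean
    becomes the sup bound with [M = 0]. *)
Lemma const_kernel : is_kernel (fun _ : R => 1 : R) (fun=> 0) 1.
Proof.
split=> [x|x|x|//|//].
- exact: is_derive_cst.
- exact: cvg_cst.
- by rewrite normr1 normr0.
Qed.

Lemma smoothed_const z t : smoothed rho J (fun _ => 1) z t = \int[mu]_(x in I01) rho x t.
Proof.
rewrite /smoothed /pairing.
under [X in _ + X]eq_Rintegral do rewrite /odd_part subrr mul0r mulr0.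
rewrite Rintegral_cst ?mul0r ?addr0; last exact: mI01.
by apply: eq_Rintegral => x _; rewrite /even_part divff ?mulr1.
Qed.

Lemma mean_eq0_preserved k a b : 0 <= a ->
  (forall t, a < t < b -> alpha t = k) -> 0 <= d * k ->
  \int[mu]_(x in I01) rho x a = 0 ->
  forall t, a <= t <= b -> \int[mu]_(x in I01) rho x t = 0.
Proof.
move=> a0 alE dk0 r0 t tab; apply/eqP; rewrite -normr_le0.
rewrite -(smoothed_const 0 t).
have u0 z : `|smoothed rho J (fun _ => 1) z a| <= 0 by rewrite smoothed_const r0 normr0.
exact: (smoothed_sup_le const_kernel sol a0 alE dk0 u0 0 tab).
Qed.

Lemma ae_bounded_LinftyI M (f : R -> R) : 0 <= M -> ae_bounded M f -> LinftyI f.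
Proof.
move=> M0 [mf fM]; rewrite /LinftyI inE; apply/andP; split; rewrite inE/=.
  by apply/(measurable_restrictT f (@mI01 R)).
by rewrite /finite_norm (le_lt_trans (normIy_le M0 fM))// ltry.
Qed.

(** The odd part is dominated by the even one, whose integral over [I] is the mass of the kernel
    there, at most [h]. Thus [rho] and [J] contribute at most [M * h] each. *)
Lemma initial_bound M h n z : 0 <= M -> ae_bounded M rho0 -> ae_bounded M J0 ->
  0 < h <= 1 -> `|smoothed rho J (box_kernel h n) z 0| <= M * (2 * h).
Proof.
move=> M0 [_ rM] [_ JM] h01.
have hpsi := box_kernelP h n; have [_ _ _ ev per] := hpsi.
have cst_cont : continuous (fun _ : R => z) by move=> s; exact: cvg_cst.
have cr := sol_rho sol; have cJ := sol_J sol.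
have rL : LinftyI (rho^~ 0) by case: cr => + _; apply.
have JL : LinftyI (J^~ 0) by case: cJ => + _; apply.
have [_ _ init _ _] := sol.
have rb : ae_bounded M (rho^~ 0).
  split; first by have [? _ []] := LinftyI_ae_bounded rL.
  apply: filterS2 rM init; first exact: (ae_filter_ringOfSetsType mu).
  by move=> x rM init Ix; have [-> _] := init Ix; exact: rM.
have Jb : ae_bounded M (J^~ 0).
  split; first by have [? _ []] := LinftyI_ae_bounded JL.
  apply: filterS2 JM init; first exact: (ae_filter_ringOfSetsType mu).
  by move=> x JM init Ix; have [_ ->] := init Ix; exact: JM.
have ce := continuous2_even_part hpsi cst_cont.
have co := continuous2_odd_part hpsi cst_cont.
have ie : mu.-integrable I01 (EFin \o even_part (box_kernel h n) z).
  apply: within_itv_integrable; apply: continuous_subspaceT.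
  exact: (@continuous_sectionx _ _ 0 ce).
have io : mu.-integrable I01 (EFin \o odd_part (box_kernel h n) z).
  apply: within_itv_integrable; apply: continuous_subspaceT.
  exact: (@continuous_sectionx _ _ 0 co).
have e0 x : 0 <= even_part (box_kernel h n) z x.
  have /andP[s0 _] := box_kernel_itv h n (x - z).
  by have /andP[s1 _] := box_kernel_itv h n (- x - z); rewrite divr_ge0// addr_ge0.
have mass : \int[mu]_(x in I01) even_part (box_kernel h n) z x <= h.
  have -> : \int[mu]_(x in I01) even_part (box_kernel h n) z x =
      \int[mu]_(x in I01) box_kernel h n x.
    have := periodic_window_const (kernel_continuous hpsi) per z ev.
    rewrite (_ : \int[mu]_(x in _) _ =
        2 * \int[mu]_(x in I01) even_part (box_kernel h n) z x); last first.
      rewrite -RintegralZl//.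
      by apply: eq_Rintegral => x _; rewrite /even_part; field.
    by apply: mulfI.
  exact: box_kernel_mass.
have bnd (f c : R -> R) : ae_bounded M f -> mu.-integrable I01 (EFin \o c) ->
    mu.-integrable I01 (EFin \o (fun x => f x * c x)) ->
    (forall x, `|c x| <= even_part (box_kernel h n) z x) ->
    `|\int[mu]_(x in I01) (f x * c x)| <= M * h.
  move=> fb ic ifc cle; apply: le_trans (ae_bounded_pairing_le M0 fb ic ifc) _.
  rewrite ler_wpM2l// (le_trans _ mass)//; apply: le_Rintegral => //.
  exact: Rintegral_norm_integrable.
rewrite /smoothed (le_trans (ler_normD _ _))//.
rewrite (_ : M * (2 * h) = M * h + M * h); last by ring.
apply: lerD; apply: bnd => //.
- exact: (pairing_integrable cr ce (lexx 0)).
- by move=> x; rewrite ger0_norm.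
- exact: (pairing_integrable cJ co (lexx 0)).
- move=> x; have /andP[s0 _] := box_kernel_itv h n (x - z).
  have /andP[s1 _] := box_kernel_itv h n (- x - z).
  by rewrite /odd_part /even_part ler_norml; apply/andP; split; lra.
Qed.

(** Dividing by the length [2 * h] of the balls bounds both [(rho + J) / 2] and [(rho - J) / 2] by
    [M]; their sum and difference cost the factor [2]. *)
Lemma norm_le_of_smoothed M t : 0 <= t -> 0 <= M ->
  (forall h n z, 0 < h <= 1 -> `|smoothed rho J (box_kernel h n) z t| <= M * (2 * h)) ->
  (normI +oo (J^~ t) <= (2 * M)%:E)%E /\ (normI +oo (rho^~ t) <= (2 * M)%:E)%E.
Proof.
move=> t0 M0 uM; have cr := sol_rho sol; have cJ := sol_J sol.
have rL : LinftyI (rho^~ t) by case: cr => + _; apply.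
have JL : LinftyI (J^~ t) by case: cJ => + _; apply.
(* [sg = 1] gives the right-moving half, seen from the centre [y]; [sg = -1] gives the left-moving
   half, seen from the mirrored centre [- y]. *)
have main (sg : R) : `|sg| = 1 -> {ae mu, forall x, I01 x -> `|(rho x t + sg * J x t) / 2| <= M}.
  move=> sg1; pose f x := (rho x t + sg * J x t) / 2.
  have fL : LinftyI f.
    have [N1 N10 [mr hN1]] := LinftyI_ae_bounded rL.
    have [N2 N20 [mJ hN2]] := LinftyI_ae_bounded JL.
    apply: (@ae_bounded_LinftyI (N1 + N2)); first exact: addr_ge0.
    split.
      apply: measurable_funM => //; apply: measurable_funD => //; exact: measurable_funM.
    apply: filterS2 hN1 hN2; first exact: (ae_filter_ringOfSetsType mu).
    move=> x h1 h2 Ix; have {}h1 := h1 Ix; have {}h2 := h2 Ix.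
    rewrite /f normrM (ger0_norm (_ : 0 <= 2^-1))//.
    have : `|rho x t + sg * J x t| <= N1 + N2.
      by rewrite (le_trans (ler_normD _ _))// lerD// normrM sg1 mul1r.
    have := normr_ge0 (rho x t + sg * J x t); lra.
  apply: (ae_le_of_averages fL) => y h h0 hy yh.
  have lim := box_kernel_cvg_ball fL h0 hy yh.
  have h1 : 0 < h <= 1 by rewrite h0/=; lra.
  have fE n : \int[mu]_(x in I01) (f x * box_kernel h n (x - y)) =
      smoothed rho J (box_kernel h n) (sg * y) t.
    have hpsi := box_kernelP h n; have [_ _ _ ev per] := hpsi.
    have cst_cont : continuous (fun _ : R => sg * y) by move=> s; exact: cvg_cst.
    rewrite /smoothed /pairing -RintegralD//; last 2 first.
      exact: (pairing_integrable cr (continuous2_even_part hpsi cst_cont) t0).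
      exact: (pairing_integrable cJ (continuous2_odd_part hpsi cst_cont) t0).
    apply: eq_Rintegral => x /set_mem Ix; have r0 := box_kernel_reflected n Ix h0 hy yh.
    rewrite /f /even_part /odd_part.
    have : sg = 1 \/ sg = -1.
      by move/eqP: sg1; rewrite eqr_norml ler01 andbT => /orP[/eqP|/eqP]; [left|right].
    case=> ->.
      by rewrite !mul1r r0; field.
    have e1 : box_kernel h n (x - - y) = 0 by rewrite opprK -ev opprD.
    have e2 : box_kernel h n (- x - - y) = box_kernel h n (x - y).
      by rewrite opprK -ev opprD opprK.
    by rewrite !mulN1r e1 e2; field.
  apply/ler_addgt0Pr => e e0.
  move/cvgrPdist_le : lim => /(_ _ e0)[n _ /(_ n (leqnn n))]; rewrite fE => le_e.
  have := uM h n (sg * y) h1; move: le_e; rewrite !ler_norml => /andP[? ?] /andP[? ?].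
  by apply/andP; split; lra.
have H1 := main 1 (normr1 _); have H2 := main (-1) (normrN1 _).
have M20 : 0 <= 2 * M by rewrite mulr_ge0.
split; apply: normIy_le => //.
  apply: filterS2 H1 H2; first exact: (ae_filter_ringOfSetsType mu).
  move=> x h1 h2 Ix; have := h1 Ix; have := h2 Ix.
  by rewrite !ler_norml => /andP[? ?] /andP[? ?]; apply/andP; split; lra.
apply: filterS2 H1 H2; first exact: (ae_filter_ringOfSetsType mu).
move=> x h1 h2 Ix; have := h1 Ix; have := h2 Ix.
by rewrite !ler_norml => /andP[? ?] /andP[? ?]; apply/andP; split; lra.
Qed.

End propagation.

(** * Iteration over unit time steps and on-off periods *)

Section decay_estimates.
Context {R : realType}.
Notation mu := (@lebesgue_measure R).
Notation I01 := (`[0%R, 1%R]%classic : set R).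

(** Replacing [(1 + d) ^+ 2] by [1] in [calC d] leaves exactly the left side, and it multiplies the
    nonnegative [expR d - d - 1]. *)
Lemma contraction_factor_le (d : R) : 0 <= d -> expR (- d) * (expR d - d) <= calC d.
Proof.
move=> d0; rewrite /calC ler_wpM2l ?expR_ge0//.
have := expR_ge1Dx d; set E := expR d => dE.
have : 0 <= ((1 + d) ^+ 2 - 1) * (E - d - 1).
  by rewrite mulr_ge0//; [rewrite expr2; nra|lra].
lra.
Qed.

Context (d : R) (d0 : 0 < d).
Context (alpha rho0 J0 : R -> R) (rho J : R -> R -> R).
Context (sol : weak_solution d alpha rho0 J0 rho J).

Section one_kernel.
Context (psi dpsi : R -> R) (C : R) (hpsi : is_kernel psi dpsi C).

(** The zero mean travels with the sup bound because each contraction step requires both at its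
    starting time. *)
Definition controlled t M :=
  \int[mu]_(x in I01) rho x t = 0 /\ forall z, `|smoothed rho J psi z t| <= M.

Lemma controlled_weaken k a b M : 0 <= a -> (forall t, a < t < b -> alpha t = k) ->
  0 <= k -> controlled a M -> forall t, a <= t <= b -> controlled t M.
Proof.
move=> a0 alE k0 [r0 uM] t tab; have dk0 : 0 <= d * k by rewrite mulr_ge0// ltW.
split; first exact: (mean_eq0_preserved sol a0 alE dk0 r0 tab).
by move=> z; exact: (smoothed_sup_le hpsi sol a0 alE dk0 uM z tab).
Qed.

Lemma controlled_contract n a M : 0 <= a -> (forall t, a < t < a + n%:R -> alpha t = 1) ->
  controlled a M -> controlled (a + n%:R) (calC d ^+ n * M).
Proof.
move=> a0; elim: n => [|n IH] alE ca; first by rewrite addr0 expr0 mul1r.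
have {IH}cn : controlled (a + n%:R) (calC d ^+ n * M).
  apply: IH => // t /andP[at_ tn]; apply: alE; rewrite at_ (lt_le_trans tn)//.
  by rewrite lerD2l ler_nat.
have an0 : 0 <= a + n%:R by rewrite addr_ge0.
have anE : a + n.+1%:R = a + n%:R + 1 by rewrite -addrA natr1.
have alE' t : a + n%:R < t < a + n.+1%:R -> alpha t = 1.
  move=> /andP[ant tan]; apply: alE; rewrite tan andbT.
  by rewrite (le_lt_trans _ ant)// lerDl.
have d1 : 0 <= d * 1 by rewrite mulr1 ltW.
have le_an : a + n%:R <= a + n.+1%:R by rewrite lerD2l ler_nat.
split.
  by apply: (mean_eq0_preserved sol an0 alE' d1 cn.1); rewrite le_an lexx.
move=> z; have M0 : 0 <= calC d ^+ n * M := le_trans (normr_ge0 _) (cn.2 0).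
apply: le_trans (smoothed_contraction hpsi sol an0 le_an alE' d1 anE cn.1 cn.2 z) _.
by rewrite mulr1 exprS -[leRHS]mulrA ler_wpM2r// contraction_factor_le// ltW.
Qed.

Lemma on_off_shift T1 T2 n t : on_off alpha T1 T2 -> 0 < t -> alpha (t + n%:R * T2) = alpha t.
Proof.
move=> [T12 _ _ per] t0; have T20 : 0 < T2 by case/andP: T12; exact: lt_trans.
elim: n => [|n IH]; first by rewrite mul0r addr0.
rewrite -natr1 mulrDl mul1r addrA per; first exact: IH.
by rewrite ltr_wpDr// mulr_ge0// ltW.
Qed.

(** The left end is excluded because periodicity is assumed at positive times only; the propagation
    lemmas look at [alpha] on open intervals, so this suffices. *)
Lemma on_off_on T1 T2 n t : on_off alpha T1 T2 ->
  n%:R * T2 < t < n%:R * T2 + T1 -> alpha t = 1.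
Proof.
move=> oo /andP[t1 t2]; rewrite -(subrK (n%:R * T2) t) (on_off_shift _ oo); last by rewrite subr_gt0.
by case: oo => _ on _ _; apply: on; lra.
Qed.

Lemma on_off_off T1 T2 n t : on_off alpha T1 T2 ->
  n%:R * T2 + T1 < t < n.+1%:R * T2 -> alpha t = 0.
Proof.
move=> oo; rewrite -natr1 mulrDl mul1r => /andP[t1 t2].
have T10 : 0 < T1 by case: oo => /andP[].
rewrite -(subrK (n%:R * T2) t) (on_off_shift _ oo); last by lra.
by case: oo => _ _ off _; apply: off; lra.
Qed.

(** In each period, [m] full units of the on phase contract. The rest of the on phase and the off
    phase, where [k = 0], merely keep the bound. *)
Lemma controlled_period T1 T2 m n M : on_off alpha T1 T2 -> m%:R <= T1 ->
  controlled 0 M -> controlled (n%:R * T2) ((calC d ^+ m) ^+ n * M).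
Proof.
move=> oo mT1 c0; have [/andP[T10 T12] _ _ _] := oo; have T20 := lt_trans T10 T12.
elim: n => [|n IH]; first by rewrite mul0r expr0 mul1r.
set a := n%:R * T2 in IH; have a0 : 0 <= a by rewrite mulr_ge0// ltW.
have aE : n.+1%:R * T2 = a + T2 by rewrite -natr1 mulrDl mul1r.
have m0 : 0 <= m%:R :> R by [].
have h1 : controlled (a + m%:R) (calC d ^+ m * ((calC d ^+ m) ^+ n * M)).
  apply: controlled_contract => // t tam; apply: (@on_off_on T1 T2 n t oo).
  by rewrite -/a; case/andP: tam => ? ?; lra.
have h2 : controlled (a + T1) (calC d ^+ m * ((calC d ^+ m) ^+ n * M)).
  apply: (@controlled_weaken 1 (a + m%:R) (a + T1)) h1 _ _ => //; [lra| |lra].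
  move=> t tam; apply: (@on_off_on T1 T2 n t oo); rewrite -/a; case/andP: tam => ? ?; lra.
rewrite exprS -mulrA.
apply: (@controlled_weaken 0 (a + T1) (a + T2)) h2 _ _ => //; [lra| |lra].
by move=> t; rewrite -aE; exact: on_off_off.
Qed.

Lemma controlled_on_off T1 T2 m n M t : on_off alpha T1 T2 -> m%:R <= T1 ->
  controlled 0 M -> n%:R * T2 <= t <= n.+1%:R * T2 ->
  controlled t ((calC d ^+ m) ^+ n * M).
Proof.
move=> oo mT1 c0 /andP[nt tn]; have [/andP[T10 T12] _ _ _] := oo; have T20 := lt_trans T10 T12.
have cn := controlled_period n oo mT1 c0.
have a0 : 0 <= n%:R * T2 by rewrite mulr_ge0// ltW.
have on_ t' : n%:R * T2 < t' < n%:R * T2 + T1 -> alpha t' = 1 by exact: on_off_on.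
have off_ t' : n%:R * T2 + T1 < t' < n.+1%:R * T2 -> alpha t' = 0 by exact: on_off_off.
have [tT|tT] := leP t (n%:R * T2 + T1).
  by apply: (controlled_weaken a0 on_ _ cn) => //; rewrite nt.
have c1 : controlled (n%:R * T2 + T1) ((calC d ^+ m) ^+ n * M).
  by apply: (controlled_weaken a0 on_ _ cn) => //; rewrite lexx lerDl ltW.
have a1 : 0 <= n%:R * T2 + T1 by lra.
by apply: (controlled_weaken a1 off_ _ c1) => //; rewrite (ltW tT).
Qed.

End one_kernel.

Lemma initial_mean : LinftyI rho0 -> (\int[mu]_(x in `[0%R, 1%R]) (rho0 x)%:E = 0)%E ->
  \int[mu]_(x in I01) rho x 0 = 0.
Proof.
move=> r0L hmean; rewrite /Rintegral; transitivity (fine (0 : \bar R)%E) => //.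
rewrite -hmean; congr fine; have [_ _ init _ _] := sol.
have rL : LinftyI (rho^~ 0) by case: (sol_rho sol) => + _; apply.
apply: ae_eq_integral; first exact: mI01.
- by apply/measurable_EFinP; have [? _ []] := LinftyI_ae_bounded rL.
- by apply/measurable_EFinP; have [? _ []] := LinftyI_ae_bounded r0L.
- apply: filterS init; first exact: (ae_filter_ringOfSetsType mu).
  by move=> x init Ix; have [-> _] := init Ix.
Qed.

End decay_estimates.

(* Part (a) is the case [m = T = 1], part (b) the case of the period [T] and
   the integer part [m] of [T1]. *)
Lemma geometric_le_exp (R : realType) (c T t : R) (m : nat) : 0 < c < 1 -> 0 < T -> 0 <= t ->
  (c ^+ m) ^+ (Num.truncn (t / T)) <=
  expR (m%:R * `|ln c|) * expR (- (m%:R / T * `|ln c| * t)).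
Proof.
move=> /andP[c0 c1] T0 t0; set n := Num.truncn _.
have lc : `|ln c| = - ln c by rewrite ltr0_norm// ln_lt0// c0.
have cE : c = expR (- `|ln c|) by rewrite lc opprK lnK.
have tT : 0 <= t / T by rewrite divr_ge0// ltW.
have /andP[_ tn] := truncn_itv tT; rewrite -/n -natr1 in tn.
rewrite [in leLHS]cE -!expRM_natl -expRD ler_expR.
have L0 : 0 <= m%:R * `|ln c| by rewrite mulr_ge0.
have -> : m%:R / T * `|ln c| * t = m%:R * `|ln c| * (t / T) by ring.
have := ler_wpM2l L0 (ltW tn).
have -> : n%:R * (m%:R * - `|ln c|) = - (m%:R * `|ln c| * n%:R) by ring.
by rewrite mulrDr mulr1; lra.
Qed.

Theorem theorem1p3 (R : realType) (dstar d : R) (rho0 J0 : R -> R)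
    (hdstar : is_dstar dstar) (hd : 0 < d < dstar)
    (hrho0 : LinftyI rho0) (hJ0 : LinftyI J0)
    (hmean : (\int[@lebesgue_measure R]_(x in `[0%R, 1%R]) (rho0 x)%:E = 0)%E) :
  (forall alpha : R -> R, (forall t : R, 0 <= t -> alpha t = 1) ->
     exists C1 C2 C3 : R,
       [/\ 0 < C1, 0 < C2, 0 < C3, C3 = `|ln (calC d)| &
           forall rho J : R -> R -> R,
             weak_solution d alpha rho0 J0 rho J ->
             forall t : R, 0 <= t ->
               (normI +oo (J^~ t) <= (C1 * expR (- (C3 * t)))%:E)%E /\
               (normI +oo (rho^~ t) <= (C2 * expR (- (C3 * t)))%:E)%E])
  /\
  (forall (alpha : R -> R) (T1 T2 : R), on_off alpha T1 T2 -> 1 <= T1 ->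
     exists C1 C2 : R,
       [/\ 0 < C1, 0 < C2 &
           let C3 := (Num.floor T1)%:~R / T2 * `|ln (calC d)| in
           forall rho J : R -> R -> R,
             weak_solution d alpha rho0 J0 rho J ->
             forall t : R, 0 <= t ->
               (normI +oo (J^~ t) <= (C1 * expR (- (C3 * t)))%:E)%E /\
               (normI +oo (rho^~ t) <= (C2 * expR (- (C3 * t)))%:E)%E]).
Proof.
have /andP[d0 dd] := hd.
have c01 : 0 < calC d < 1 by case: hdstar => _ _ /(_ d hd).
have [M1 M10 [mr rM1]] := LinftyI_ae_bounded hrho0.
have [M2 M20 [mJ JM2]] := LinftyI_ae_bounded hJ0.
(* The summand [1] keeps [M], and with it the final constants, positive even for zero data. *)
pose M := M1 + M2 + 1; have M0 : 0 < M by rewrite /M; lra.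
have rb : ae_bounded M rho0.
  split => //; apply: filterS rM1; first exact: (ae_filter_ringOfSetsType (@lebesgue_measure R)).
  by move=> x h Ix; apply: le_trans (h Ix) _; rewrite /M; lra.
have Jb : ae_bounded M J0.
  split => //; apply: filterS JM2; first exact: (ae_filter_ringOfSetsType (@lebesgue_measure R)).
  by move=> x h Ix; apply: le_trans (h Ix) _; rewrite /M; lra.
have init alpha rho J h n : weak_solution d alpha rho0 J0 rho J -> 0 < h <= 1 ->
    controlled rho J (box_kernel h n) 0 (M * (2 * h)).
  move=> sol h01; split; first exact: (initial_mean sol hrho0 hmean).
  by move=> z; exact: (initial_bound sol n z (ltW M0) rb Jb h01).
have L0 : 0 < `|ln (calC d)| by rewrite normr_gt0 lt_eqF// ln_lt0.
(* [th] is the discrete decay factor reached at time [t], and [K * e] its exponential majorant. *)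
have conclude alpha rho J t th K e : weak_solution d alpha rho0 J0 rho J -> 0 <= t -> 0 <= th ->
    th <= K * e -> (forall h n, 0 < h <= 1 ->
      controlled rho J (box_kernel h n) t (th * (M * (2 * h)))) ->
    (normI +oo (J^~ t) <= (2 * M * K * e)%:E)%E /\ (normI +oo (rho^~ t) <= (2 * M * K * e)%:E)%E.
  move=> sol t0 th0 thK ctl.
  have [|] := @norm_le_of_smoothed _ d alpha rho0 J0 rho J sol (th * M) t t0 (mulr_ge0 th0 (ltW M0)).
    by move=> h n z h01; rewrite -mulrA; case: (ctl h n h01) => _; exact.
  have le : ((2 * (th * M))%:E <= (2 * M * K * e)%:E)%E.
    rewrite lee_fin (_ : 2 * (th * M) = 2 * M * th); last by ring.
    by rewrite -[leRHS]mulrA ler_wpM2l// mulr_ge0// ltW.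
  by move=> h1 h2; split; [exact: le_trans h1 le|exact: le_trans h2 le].
split.
(* Only completed units of time contract. The unfinished last one costs at most one factor [calC d],
   which [K] compensates. *)
- move=> alpha al1; pose K := expR `|ln (calC d)|.
  have K0 : 0 < 2 * M * K by rewrite !mulr_gt0// expR_gt0.
  exists (2 * M * K), (2 * M * K), `|ln (calC d)|; split => // rho J sol t t0.
  have := geometric_le_exp 1 c01 (@ltr01 R) t0; rewrite invr1 !mulr1 !mul1r expr1.
  set n := Num.truncn t => thK.
  apply: (conclude alpha rho J t (calC d ^+ n)) => //.
    by rewrite exprn_ge0// ltW//; case/andP: c01.
  move=> h m h01; have hpsi := box_kernelP h m.
  have /andP[nt tn] := truncn_itv t0.
  have al a b s : 0 <= a -> a < s < b -> alpha s = 1.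
    by move=> a0 /andP[as_ _]; apply: al1; rewrite ltW// (le_lt_trans a0).
  have cn : controlled rho J (box_kernel h m) n%:R (calC d ^+ n * (M * (2 * h))).
    rewrite -[n%:R]add0r; apply: (controlled_contract d0 sol hpsi) => //.
      by move=> s; exact: al.
    exact: init sol h01.
  apply: (controlled_weaken (b := t + 1) d0 sol hpsi (ler0n _ n) _ ler01 cn).
    by move=> s; exact: al.
  by rewrite nt/= lerDl.
- move=> alpha T1 T2 oo T11; have [/andP[T10 T12] _ _ _] := oo; have T20 := lt_trans T10 T12.
  pose m := Num.truncn T1.
  have /andP[mT1 _] := truncn_itv (ltW T10).
  have mE : (Num.floor T1)%:~R = m%:R :> R.
    by rewrite /m truncn_floor (ltW T10) natr_absz ger0_norm// floor_ge0 ltW.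
  (* Here the unfinished last period may lose all its [m] contractions, hence the power [m] in the
     compensating constant. *)
  pose K := expR (m%:R * `|ln (calC d)|).
  have K0 : 0 < 2 * M * K by rewrite !mulr_gt0// expR_gt0.
  exists (2 * M * K), (2 * M * K); split => //= rho J sol t t0; rewrite mE.
  apply: (conclude alpha rho J t _ K _ sol t0 _ (geometric_le_exp m c01 T20 t0)).
    by rewrite !exprn_ge0// ltW//; case/andP: c01.
  move=> h n h01; have hpsi := box_kernelP h n.
  apply: (controlled_on_off d0 sol hpsi oo mT1 (init _ _ _ h n sol h01)).
  have tT : 0 <= t / T2 by rewrite divr_ge0// ltW.
  have /andP[nt tn] := truncn_itv tT.
  by rewrite -ler_pdivlMr// nt/= -ler_pdivrMr// ltW.
Qed.
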